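(* Let $\mathbb{F}$ be a field. There exist finite uniform ranked posets $\Gamma$ for which the $\mathbb{F}$-algebra $R_\Gamma$ is numerically Koszul but not Koszul; moreover, there exist cyclic posets $\Gamma$ with these properties.
   Context: Fix a field $\mathbb{F}$. A poset $\Gamma$ with unique minimal element $*$ and strict order $<$ is ranked if for all $b\in\Gamma$ any two maximal chains in $[*,b]$ have the same length; this length is the rank $rk_\Gamma(b)$ (so $rk_\Gamma( * )=0$). For $x\in\Gamma$, $\Gamma_x=[*,x]$ and $S_x(k)=\{y\in\Gamma_x : rk_\Gamma(y)=rk_\Gamma(x)-k\}$. $\Gamma$ is cyclic if $\Gamma=\Gamma_x$ for some $x\in\Gamma$. Uniform: for $a,b\in S_x(1)$ write $a\sim_x b$ if there is $c\in S_a(1)\cap S_b(1)$, and extend $\sim_x$ to an equivalence relation on $S_x(1)$; $\Gamma$ is uniform if for every $x\ne *$ the relation $\sim_x$ has a unique equivalence class. The algebra $R_\Gamma$: generators $r_x$ for $*\neq x\in\Gamma$, and relations $r_xr_y=0$ whenever $y\notin S_x(1)$, and $r_x\sum_{y\in S_x(1)}r_y=0$ for all $x$ (terms with $y=*$ are omitted). It is a quadratic algebra graded with each $r_x$ of degree 1. A graded connected $\mathbb{F}$-algebra $R$ is Koszul if the bigraded Yoneda algebra $\mathrm{Ext}_R^{*,*}(\mathbb{F},\mathbb{F})$ is generated as an $\mathbb{F}$-algebra by $\mathrm{Ext}_R^{1,1}(\mathbb{F},\mathbb{F})$. For an $\mathbb{N}$-graded algebra $R=\oplus_iR_i$ the Hilbert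 series is $H(R,t)=\sum_i\dim_{\mathbb{F}}(R_i)t^i$. A quadratic algebra $R$ with quadratic dual algebra $R^!$ is numerically Koszul if $H(R,-t)\cdot H(R^!,t)=1$. *)

(* Defs.v *)
From HB Require Import structures.
From mathcomp Require Import all_boot all_order all_algebra.
From mathcomp Require Import boolp.
From mathcomp Require Import monalg.

Set Implicit Arguments.
Unset Strict Implicit.
Unset Printing Implicit Defensive.

Import Order.TTheory GRing.Theory.
Local Open Scope ring_scope.
Local Open Scope quotient_scope.

(* A finite poset has a unique minimal element iff it has a least element, so
   the posets are taken in finBPOrderType, with * = \bot. *)
Section Posets.
Local Open Scope order_scope.
Variables (disp : Order.disp_t) (G : finBPOrderType disp).
Implicit Types (x y a b c : G) (C : {set G}).

Definition below x : {set G} := [set y | y <= x].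

Definition chain C : bool := [forall a in C, forall b in C, a >=< b].

Definition maxchain x C : bool :=
  maxset (fun D : {set G} => (D \subset below x) && chain D) C.

Definition chain_length C : nat := #|C|.-1.

Definition ranked_poset : Prop :=
  forall x C D, maxchain x C -> maxchain x D ->
    chain_length C = chain_length D.

(* When ranked_poset holds this is the common length of the maximal chains. *)
Definition rank x : nat := \max_(C : {set G} | maxchain x C) chain_length C.

Definition layer x (k : nat) : {set G} :=
  [set y in below x | rank y + k == rank x]%N.

Definition adjacent x : rel G :=
  [rel a b | [&& a \in layer x 1, b \in layer x 1 &
                 layer a 1 :&: layer b 1 != set0]].

(* adjacent x is symmetric, so that its reflexive transitive closure
   (connect) is the equivalence relation it generates. *)
Definition uniform_poset : Prop :=
  forall x, x != \bot ->
    #|equivalence_partition (connect (adjacent x)) (layer x 1)| = 1%N.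

Definition cyclic_poset : Prop := exists x, below x = [set: G].

End Posets.

Section QuadraticAlgebra.
Variables (F : fieldType) (X : finType).

Local Notation free_alg := {malg F[{fmonom X}]}.

(* V (x) V, for V the vector space with basis X; a set of quadratic relations
   is a subset of it. *)
Definition tensor2 : Type := {ffun X * X -> F}.

Definition quad_elt (q : tensor2) : free_alg :=
  \sum_p << q p *g mmul (fmu p.1) (fmu p.2) >>.

Variable Q : tensor2 -> Prop.

Inductive in_quad_ideal : free_alg -> Prop :=
| in_quad_ideal0 : in_quad_ideal 0
| in_quad_idealD u v : in_quad_ideal u -> in_quad_ideal v ->
    in_quad_ideal (u + v)
| in_quad_ideal_gen a q b : Q q -> in_quad_ideal (a * quad_elt q * b).

Definition quad_ideal (u : free_alg) : bool := `[< in_quad_ideal u >].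

Lemma quad_idealP u : reflect (in_quad_ideal u) (u \in quad_ideal).
Proof. exact: asboolP. Qed.

Lemma quad_idealMl a u : u \in quad_ideal -> a * u \in quad_ideal.
Proof.
move=> /quad_idealP uI; apply/quad_idealP; elim: uI => [|v w _ hv _ hw|b q c Qq].
- by rewrite mulr0; exact: in_quad_ideal0.
- by rewrite mulrDr; exact: in_quad_idealD.
- by rewrite !mulrA; exact: in_quad_ideal_gen.
Qed.

Lemma quad_idealMr a u : u \in quad_ideal -> u * a \in quad_ideal.
Proof.
move=> /quad_idealP uI; apply/quad_idealP; elim: uI => [|v w _ hv _ hw|b q c Qq].
- by rewrite mul0r; exact: in_quad_ideal0.
- by rewrite mulrDl; exact: in_quad_idealD.
- by rewrite -mulrA; exact: in_quad_ideal_gen.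
Qed.

Lemma quad_ideal_zmod_closed : zmod_closed quad_ideal.
Proof.
split=> [|u v uI vI]; first by apply/quad_idealP; exact: in_quad_ideal0.
apply/quad_idealP/in_quad_idealD; apply/quad_idealP => //.
by rewrite -mulN1r; exact: quad_idealMl.
Qed.

HB.instance Definition _ :=
  GRing.isZmodClosed.Build free_alg quad_ideal quad_ideal_zmod_closed.

Lemma quad_ideal1 : 1 \in quad_ideal = false.
Proof.
apply/negP => /quad_idealP I1.
suff: mcoeff mone (1 : free_alg) = 0.
  by rewrite rmorph1 => /eqP; rewrite oner_eq0.
elim: I1 => [|u v _ hu _ hv|a q b _]; first exact: raddf0.
- by rewrite raddfD /= hu hv addr0.
- rewrite !rmorphM /= [mcoeff _ (quad_elt q)](_ : _ = 0) ?mulr0 ?mul0r //.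
  rewrite raddf_sum big1 // => p _ /=; rewrite mcoeffU -fdeg_eq0.
  by rewrite fdegM !fdegU.
Qed.

Definition quad_alg : Type :=
  Quotient.quot (GRing.ZmodClosed.clone _ quad_ideal _).
HB.instance Definition _ := GRing.Zmodule.on quad_alg.
HB.instance Definition _ := EqQuotient.on quad_alg.

Definition quad_pi (u : free_alg) : quad_alg := \pi_quad_alg u.

Lemma quad_piE u v : reflect (quad_pi u = quad_pi v) (u - v \in quad_ideal).
Proof. by rewrite Quotient.idealrBE; exact: eqP. Qed.

Lemma quad_piK (a : quad_alg) : quad_pi (repr a) = a.
Proof. exact: reprK. Qed.

Lemma quad_piD u v : quad_pi (u + v) = quad_pi u + quad_pi v.
Proof. exact: (raddfD \pi_quad_alg). Qed.

Definition quad_one : quad_alg := quad_pi 1.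
Definition quad_mul (a b : quad_alg) : quad_alg := quad_pi (repr a * repr b).
Definition quad_scale (c : F) (a : quad_alg) : quad_alg := quad_pi (c *: repr a).

Lemma quad_piM u v : quad_mul (quad_pi u) (quad_pi v) = quad_pi (u * v).
Proof.
apply/quad_piE; set u' := repr _; set v' := repr _.
have uI : u' - u \in quad_ideal by apply/quad_piE; rewrite quad_piK.
have vI : v' - v \in quad_ideal by apply/quad_piE; rewrite quad_piK.
rewrite -(subrK (u' * v) (u' * v')) -mulrBr -addrA -mulrBl.
by apply: rpredD; [exact: quad_idealMl | exact: quad_idealMr].
Qed.

Lemma quad_piZ c u : quad_scale c (quad_pi u) = quad_pi (c *: u).
Proof.
apply/quad_piE; rewrite -scalerBr -mul_malgC quad_idealMl //.
by apply/quad_piE; rewrite quad_piK.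
Qed.

Lemma quad_mulA : associative quad_mul.
Proof.
by move=> a b c; rewrite -[a]quad_piK -[b]quad_piK -[c]quad_piK !quad_piM mulrA.
Qed.

Lemma quad_mul1 : left_id quad_one quad_mul.
Proof. by move=> a; rewrite -[a]quad_piK quad_piM mul1r. Qed.

Lemma quad_mulr1 : right_id quad_one quad_mul.
Proof. by move=> a; rewrite -[a]quad_piK quad_piM mulr1. Qed.

Lemma quad_mulDl : left_distributive quad_mul +%R.
Proof.
move=> a b c; rewrite -[a]quad_piK -[b]quad_piK -[c]quad_piK.
by rewrite -quad_piD !quad_piM mulrDl quad_piD.
Qed.

Lemma quad_mulDr : right_distributive quad_mul +%R.
Proof.
move=> a b c; rewrite -[a]quad_piK -[b]quad_piK -[c]quad_piK.
by rewrite -quad_piD !quad_piM mulrDr quad_piD.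
Qed.

Lemma quad_one_neq0 : quad_one != 0.
Proof.
apply/eqP; rewrite -(raddf0 \pi_quad_alg) => /quad_piE.
by rewrite subr0 quad_ideal1.
Qed.

HB.instance Definition _ := GRing.Zmodule_isNzRing.Build quad_alg
  quad_mulA quad_mul1 quad_mulr1 quad_mulDl quad_mulDr quad_one_neq0.

Lemma quad_scaleA c d a : quad_scale c (quad_scale d a) = quad_scale (c * d) a.
Proof. by rewrite -[a]quad_piK !quad_piZ scalerA. Qed.

Lemma quad_scale1 : left_id 1 quad_scale.
Proof. by move=> a; rewrite -[a]quad_piK quad_piZ scale1r. Qed.

Lemma quad_scaleDr : right_distributive quad_scale +%R.
Proof.
move=> c a b; rewrite -[a]quad_piK -[b]quad_piK.
by rewrite -quad_piD !quad_piZ scalerDr quad_piD.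
Qed.

Lemma quad_scaleDl a : {morph quad_scale^~ a : c d / c + d}.
Proof. by move=> c d; rewrite -[a]quad_piK !quad_piZ scalerDl quad_piD. Qed.

HB.instance Definition _ := GRing.Zmodule_isLmodule.Build F quad_alg
  quad_scaleA quad_scale1 quad_scaleDr quad_scaleDl.

Lemma quad_scaleAl (c : F) (a b : quad_alg) : c *: (a * b) = c *: a * b.
Proof.
rewrite -[a]quad_piK -[b]quad_piK /GRing.scale /GRing.mul /=.
by rewrite !(quad_piM, quad_piZ) scalerAl.
Qed.

HB.instance Definition _ :=
  GRing.Lmodule_isLalgebra.Build F quad_alg quad_scaleAl.

Lemma quad_scaleAr (c : F) (a b : quad_alg) : c *: (a * b) = a * (c *: b).
Proof.
rewrite -[a]quad_piK -[b]quad_piK /GRing.scale /GRing.mul /=.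
rewrite !(quad_piM, quad_piZ); congr quad_pi.
have malgCZ d (u : free_alg) : d *: u = u * malgC d.
  rewrite malgM_def malgZ_def fgmulgU; apply: eq_bigr => k _.
  by rewrite mulrC mulm1.
by rewrite !malgCZ mulrA.
Qed.

HB.instance Definition _ :=
  GRing.Lalgebra_isAlgebra.Build F quad_alg quad_scaleAr.

Definition quad_grade (n : nat) (a : quad_alg) : Prop :=
  exists2 u : free_alg,
    (forall m, mcoeff m u != 0 -> fdeg m = n) & a = quad_pi u.

(* The annihilator of Q in the dual of V (x) V, which is identified with
   V* (x) V* and written in the basis dual to X. *)
Definition quad_orth (g : tensor2) : Prop :=
  forall q, Q q -> \sum_p g p * q p = 0.

End QuadraticAlgebra.

Section HilbertSeries.
Variables (F : fieldType) (V : lmodType F).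

Definition has_dim (W : V -> Prop) (d : nat) : Prop :=
  exists e : 'I_d -> V, (forall i, W (e i)) /\
    (forall v, W v -> exists! c : {ffun 'I_d -> F}, v = \sum_i c i *: e i).

Definition hilbert_series (gr : nat -> V -> Prop) (h : nat -> nat) : Prop :=
  forall i, has_dim (gr i) (h i).

End HilbertSeries.

(* The last clause is H(R, -t) H(R^!, t) = 1, coefficient by coefficient. *)
Definition numerically_koszul (F : fieldType) (X : finType)
    (Q : tensor2 F X -> Prop) : Prop :=
  exists h h' : nat -> nat,
    [/\ hilbert_series (quad_grade (Q := Q)) h,
        hilbert_series (quad_grade (Q := quad_orth Q)) h' &
        forall n, \sum_(i < n.+1) (-1) ^+ i * (h i)%:Z * (h' (n - i)%N)%:Z
                    = (n == 0%N)%:Z].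

(* The Yoneda algebra of a connected graded algebra A with homogeneous
   components gr, as the cohomology of Hom_A(B, F) for B the reduced bar
   resolution of the trivial module F: with A_+ the sum of the gr d for d > 0,
   an n-cochain is an n-linear form on A_+, and the Yoneda product is induced,
   up to sign, by concatenation.  A cochain is represented by an n-linear
   extension to A, as a function on lists of which only the values on n-tuples
   of homogeneous elements of A_+ matter. *)
Section YonedaAlgebra.
Variables (F : fieldType) (A : algType F) (gr : nat -> A -> Prop).
Implicit Types (n j : nat) (f g h : seq A -> F) (s : seq A) (ds : seq nat).

Definition homogeneous ds s : Prop :=
  size ds = size s /\
  forall i, (i < size s)%N ->
    (0 < nth 0%N ds i)%N /\ gr (nth 0%N ds i) (nth 0 s i).

Definition multilinear n f : Prop :=
  forall s1 s2 (c : F) (a b : A), (size s1 + size s2).+1 = n ->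
    f (s1 ++ (c *: a + b) :: s2) = c * f (s1 ++ a :: s2) + f (s1 ++ b :: s2).

(* Cohomological degree n and internal degree j. *)
Definition cochain n j f : Prop :=
  multilinear n f /\
  forall ds s, size s = n -> homogeneous ds s -> sumn ds <> j -> f s = 0.

Definition eq_cochain n f g : Prop :=
  forall ds s, size s = n -> homogeneous ds s -> f s = g s.

Definition merge_at (i : nat) s : seq A :=
  take i s ++ nth 0 s i * nth 0 s i.+1 :: drop i.+2 s.

Definition differential f : seq A -> F :=
  fun s => \sum_(i < (size s).-1) (-1) ^+ i * f (merge_at i s).

Definition cocycle n j f : Prop :=
  cochain n j f /\ eq_cochain n.+1 (differential f) (fun=> 0).

Definition coboundary n j f : Prop :=
  if n is n'.+1 then
    exists2 h, cochain n' j h & eq_cochain n f (differential h)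
  else eq_cochain n f (fun=> 0).

Definition cohomologous n j f g : Prop := coboundary n j (fun s => f s - g s).

Definition concat_product n f g : seq A -> F :=
  fun s => f (take n s) * g (drop n s).

(* Cocycles representing the homogeneous elements of the subalgebra of
   Ext_A(F, F) generated by Ext^{1,1}. *)
Inductive generated_by_Ext11 : nat -> nat -> (seq A -> F) -> Prop :=
| gen_one : generated_by_Ext11 0 0 (fun=> 1)
| gen_Ext11 f : cocycle 1 1 f -> generated_by_Ext11 1 1 f
| gen_zero n j : generated_by_Ext11 n j (fun=> 0)
| gen_lin n j (c : F) f g :
    generated_by_Ext11 n j f -> generated_by_Ext11 n j g ->
    generated_by_Ext11 n j (fun s => c * f s + g s)
| gen_mul n j n' j' f g :
    generated_by_Ext11 n j f -> generated_by_Ext11 n' j' g ->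
    generated_by_Ext11 (n + n') (j + j') (concat_product n f g).

Definition koszul : Prop :=
  forall n j f, cocycle n j f ->
    exists2 g, generated_by_Ext11 n j g & cohomologous n j f g.

End YonedaAlgebra.

Section PosetAlgebra.
Local Open Scope order_scope.
Variables (F : fieldType) (disp : Order.disp_t) (G : finBPOrderType disp).

Definition nonbottom : finType := {x : G | x != \bot}.

(* The defining relations of R_G, on generators r_x for x != \bot. *)
Inductive poset_rel : tensor2 F nonbottom -> Prop :=
| poset_rel_mul (x y : nonbottom) : val y \notin layer (val x) 1 ->
    poset_rel [ffun p => (p == (x, y))%:R%R]
| poset_rel_sum (x : nonbottom) :
    poset_rel [ffun p => ((p.1 == x) && (val p.2 \in layer (val x) 1))%:R%R].

Definition poset_alg : algType F := quad_alg poset_rel.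

Definition poset_alg_koszul : Prop :=
  koszul (A := poset_alg) (quad_grade (Q := poset_rel)).

Definition poset_alg_numerically_koszul : Prop := numerically_koszul poset_rel.

End PosetAlgebra.

(* Main.v *)
Require Import Defs.
From HB Require Import structures.
From mathcomp Require Import all_boot all_order all_algebra.
From mathcomp Require Import boolp.
From mathcomp Require Import finmap monalg.
From mathcomp Require Import zify ring.

(** R_G is the direct sum of F and of the right ideals r_x R_G.  The degree n
    part of r_x R_G is the top reduced cohomology of the poset formed by the
    n - 1 ranks just below x, so its dimension differs from the Euler
    characteristic by lower Betti numbers.  When G is uniform the first ones
    that need not vanish are h^1 and h^2 of the ranks 1 to 4 below an x of rank
    5; they yield classes in Ext^{4,5} and Ext^{3,5}, and they cancel in the
    Hilbert series when h^1 = h^2.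

    The poset below realizes h^1 = h^2 = 1: the order complex of the open
    interval (Bot, Top) is covered by two contractible pieces, the elements
    below W1 and those below W2 (with W1 and W2 added), which meet in the
    disjoint union of the point Ap and of a set homotopy equivalent to a
    circle, the elements at most Y1 or Y2.

    The quadratic dual is a monoid algebra: its relations are r_x r_y = r_x r_y'
    for y, y' \in S_x(1).  A normal form for words gives its Hilbert series,
    the inverse of 1 - 15 t + 15 t^2 - 5 t^3, while R_G has Hilbert series
    1 + 15 t + 15 t^2 + 5 t^3.  R_G is not Koszul because of an explicit
    3-cocycle of internal degree 5 that does not vanish on a cycle of the bar
    complex. *)

Set Implicit Arguments.
Unset Strict Implicit.
Unset Printing Implicit Defensive.

Import Order.TTheory GRing.Theory Num.Theory.
Local Open Scope ring_scope.

(** * Linear forms and bases of quadratic algebras *)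

Section QuadAlg.
Variables (F : fieldType) (X : finType) (Q : tensor2 F X -> Prop).
Local Notation A := (quad_alg Q).
Local Notation free := {malg F[{fmonom X}]}.
Implicit Types (s t : seq X) (a b : A) (c : seq X -> F) (u v : free).

Definition qword s : A := quad_pi Q << FMonom s >>.

Lemma qword_cat s t : qword (s ++ t) = qword s * qword t.
Proof.
rewrite /qword; have -> : FMonom (s ++ t) = mmul (FMonom s) (FMonom t).
  by apply/eqP; rewrite fmP fmM.
rewrite [RHS]quad_piM; congr quad_pi.
by rewrite malgM_def fgmulUU mulr1.
Qed.

Lemma quad_pi_lin k u v : quad_pi Q (k *: u + v) = k *: quad_pi Q u + quad_pi Q v.
Proof. by rewrite quad_piD -quad_piZ. Qed.

Lemma quad_pi0 : quad_pi Q 0 = 0.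
Proof. exact: (raddf0 (\pi_(quad_alg Q)%qT)). Qed.

Lemma quad_pi_sum (I : Type) (r : seq I) (P : pred I) (f : I -> free) :
  quad_pi Q (\sum_(i <- r | P i) f i) = \sum_(i <- r | P i) quad_pi Q (f i).
Proof. exact: (raddf_sum (\pi_(quad_alg Q)%qT)). Qed.

Lemma malgUZ (k : F) (m : {fmonom X}) : << k *g m >> = k *: << m >> :> free.
Proof. by rewrite -mul_malgC malgM_def fgmulUU mulr1 mul1m. Qed.

Lemma quad_pi_word u : quad_pi Q u = \sum_(m <- msupp u) mcoeff m u *: qword m.
Proof.
rewrite [in LHS](monalgE u) quad_pi_sum; apply: eq_bigr => m _.
by rewrite malgUZ -quad_piZ /qword fmK.
Qed.

Lemma quad_rel_word q : Q q -> \sum_p q p *: qword [:: p.1; p.2] = 0.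
Proof.
move=> Qq; transitivity (quad_pi Q (quad_elt q)); last first.
  rewrite -quad_pi0; apply/quad_piE; rewrite subr0; apply/quad_idealP.
  by rewrite -[quad_elt q]mulr1 -[quad_elt q]mul1r; exact: in_quad_ideal_gen.
rewrite /quad_elt quad_pi_sum; apply: eq_bigr => p _.
rewrite malgUZ -quad_piZ /qword; congr (_ *: quad_pi _ << _ >>).
by apply/eqP; rewrite fmP fmM !fmU.
Qed.

(** A homogeneous representative expands into words of length [n], so a property stable under linear
    combinations has to be checked on words only. *)
Lemma quad_grade_ind n (P : A -> Prop) : P 0 ->
    (forall k a b, P a -> P b -> P (k *: a + b)) ->
    (forall s, size s = n -> P (qword s)) ->
  forall a, quad_grade n a -> P a.
Proof.
move=> P0 PD Pw a [u hu ->]; rewrite quad_pi_word.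
rewrite big_seq; elim/big_ind: _ => // [a' b' Pa Pb|m um].
  by rewrite -[a']scale1r; exact: PD.
rewrite -[X in P X]addr0; apply: PD => //; apply: Pw.
by rewrite -fdegE; apply: hu; rewrite mcoeff_neq0.
Qed.

Lemma quad_grade_qword s : quad_grade (size s) (qword s).
Proof.
exists << FMonom s >> => // m; rewrite mcoeffU.
by case: (FMonom s =P m) => [<- _|_]; [rewrite fdegE | rewrite mulr0n eqxx].
Qed.

Lemma quad_gradeD n (k : F) (a b : A) :
  quad_grade n a -> quad_grade n b -> quad_grade n (k *: a + b).
Proof.
move=> [u hu ->] [v hv ->]; exists (k *: u + v); last by rewrite quad_pi_lin.
move=> m; rewrite mcoeffD mcoeffZ => nz.
have [um|/hu //] := eqVneq (mcoeff m u) 0.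
by apply: hv; move: nz; rewrite um mulr0 add0r.
Qed.

(* The linear forms on a quadratic algebra are the functions on words that
   annihilate every two-sided translate of a relation. *)
Definition annihilates c : Prop := forall s t q, Q q ->
  \sum_p q p * c (s ++ p.1 :: p.2 :: t) = 0.

(** Evaluated on the chosen representative of [a]; by [qform_pi] the choice is immaterial once [c]
    annihilates the relations. *)
Definition qform c a : F :=
  mmap idfun (fun m : {fmonom X} => c m) (repr a).

Section Form.
Variables (c : seq X -> F) (cQ : annihilates c).
Local Notation wt := (mmap idfun (fun m : {fmonom X} => c m)).

(** Expanding both cofactors of a relation into monomials makes each term a multiple of an instance
    of [cQ]. *)
Lemma annihilates_ideal u : u \in quad_ideal Q -> wt u = 0.
Proof.
move/quad_idealP; elim=> [|v w _ hv _ hw|a q b Qq]; first exact: raddf0.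
  by rewrite raddfD /= hv hw addr0.
rewrite {1}(monalgE a) -mulrA mulr_suml raddf_sum big1 //= => m _.
rewrite mulrA {1}(monalgE b) mulr_sumr raddf_sum big1 //= => m' _.
rewrite /quad_elt mulr_sumr mulr_suml raddf_sum /=.
transitivity (\sum_p mcoeff m a * mcoeff m' b *
                      (q p * c (m ++ p.1 :: p.2 :: m'))); last first.
  by rewrite -mulr_sumr cQ ?mulr0.
apply: eq_bigr => p _.
rewrite !malgM_def !fgmulUU mmapU /= !fmM !fmU -!catA /=.
by rewrite mulrA (mulrAC (mcoeff m a)).
Qed.

Lemma qform_pi u : qform c (quad_pi Q u) = wt u.
Proof.
rewrite /qform; apply/eqP; rewrite -subr_eq0 -raddfB /=; apply/eqP.
by apply: annihilates_ideal; apply/quad_piE; rewrite quad_piK.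
Qed.

Lemma qform_word s : qform c (qword s) = c s.
Proof. by rewrite qform_pi mmapU /= mul1r. Qed.

Lemma qform_lin k a b : qform c (k *: a + b) = k * qform c a + qform c b.
Proof.
rewrite -[a]quad_piK -[b]quad_piK -quad_pi_lin !qform_pi raddfD /=.
congr (_ + _); rewrite (mmapEw (msuppZ_le _ _)) mmapE big_distrr /=.
by apply: eq_bigr => m _; rewrite mcoeffZ mulrA.
Qed.

Lemma qform0 : qform c 0 = 0.
Proof. by rewrite -quad_pi0 qform_pi raddf0. Qed.

Lemma qform_sum (I : Type) (r : seq I) (P : pred I) (f : I -> A) (k : I -> F) :
  qform c (\sum_(i <- r | P i) k i *: f i) =
  \sum_(i <- r | P i) k i * qform c (f i).
Proof.
by elim/big_rec2: _ => [|i a b _ <-]; rewrite ?qform0 // qform_lin.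
Qed.

End Form.

(** The words of [N] span by the last hypothesis; the forms [c t], dual to them, make the
    coordinates unique. *)
Lemma quad_has_dim n (N : seq (seq X)) (c : seq X -> seq X -> F) :
    uniq N -> {in N, forall t, size t = n} ->
    (forall t, t \in N -> annihilates (c t)) ->
    {in N &, forall t s, c t s = (t == s)%:R} ->
    (forall s, size s = n -> qword s = \sum_(t <- N) c t s *: qword t) ->
  has_dim (quad_grade (Q := Q) n) (size N).
Proof.
move=> uN sN cQ cN wE.
pose w (i : 'I_(size N)) := nth [::] N i.
have wN i : w i \in N by exact: mem_nth.
have sumw (f : seq X -> A) : \sum_(t <- N) f t = \sum_i f (w i).
  by rewrite (big_nth [::]) big_mkord.
have dual i (k : 'I_(size N) -> F) :
    qform (c (w i)) (\sum_j k j *: qword (w j)) = k i.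
  rewrite qform_sum; last exact: cQ.
  rewrite (bigD1 i) //= big1 => [|j ji]; rewrite (qform_word (cQ _ (wN i))) cN //.
    by rewrite eqxx mulr1 addr0.
  by rewrite nth_uniq // (inj_eq val_inj) eq_sym (negPf ji) mulr0.
exists (fun i => qword (w i)); split=> [i|a].
  by rewrite -(sN (w i)) //; exact: quad_grade_qword.
move=> ha; exists [ffun i => qform (c (w i)) a]; split; last first.
  by move=> k ->; apply/ffunP=> i; rewrite ffunE dual.
under eq_bigr => i _ do rewrite ffunE.
move: a ha; apply: quad_grade_ind => [|k a b ha hb|s ss].
- by rewrite big1 // => i _; rewrite qform0 ?scale0r //; exact: cQ.
- rewrite {1}ha {1}hb scaler_sumr -big_split /=; apply: eq_bigr => i _.
  by rewrite (qform_lin (cQ _ (wN i))) scalerDl scalerA.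
- apply: etrans (wE _ ss) _; rewrite sumw; apply: eq_bigr => i _.
  by rewrite (qform_word (cQ _ (wN i))).
Qed.

End QuadAlg.

(** * Graded posets *)

Section GradedPoset.
Local Open Scope order_scope.
Variables (disp : Order.disp_t) (G : finBPOrderType disp) (lvl : G -> nat).
Hypothesis lvl0 : lvl \bot = 0%N.
Hypothesis lvl_lt : forall x y, x < y -> (lvl x < lvl y)%N.
Hypothesis lvl_dense :
  forall x y, x < y -> ((lvl x).+1 < lvl y)%N -> exists2 z, x < z & z < y.

(** On a chain [lvl] is injective; maximality and [lvl_dense] make it onto the interval from 0 to
    [lvl x]. *)
Lemma card_maxchain x (C : {set G}) : maxchain x C -> #|C| = (lvl x).+1.
Proof.
case/maxsetP=> /andP[/subsetP Cx Cch] Cmax.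
have Ccmp a b : a \in C -> b \in C -> a >=< b.
  by move=> aC bC; move/forall_inP: Cch => /(_ a aC)/forall_inP/(_ b bC).
have add z : z <= x -> {in C, forall c, z >=< c} -> z \in C.
  move=> zx zC; suff <- : z |: C = C by rewrite setU11.
  apply: Cmax; last exact: subsetUr.
  apply/andP; split.
    by apply/subsetP=> c; rewrite in_setU1 => /orP[/eqP->|/Cx //]; rewrite inE.
  apply/forall_inP => a aC; apply/forall_inP => b.
    move: aC; rewrite !in_setU1 => /orP[/eqP->|aC] /orP[/eqP->|bC].
  - by rewrite /Order.comparable lexx.
  - exact: zC.
  - by rewrite comparable_sym zC.
  - exact: Ccmp.
have xC : x \in C.
  apply: add => // c /Cx; rewrite inE => cx; by rewrite comparable_sym /Order.comparable cx.
have botC : \bot \in C by apply: add => [|c _]; rewrite ?le0x // /Order.comparable le0x.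
have lvlC c d : c \in C -> d \in C -> (lvl c < lvl d)%N -> c < d.
  move=> cC dC cd; have := Ccmp c d cC dC.
  case/orP; rewrite le_eqVlt => /orP[/eqP e|//].
  - by rewrite e ltnn in cd.
  - by rewrite e ltnn in cd.
  - by move/lvl_lt => dc; move: (ltn_trans cd dc); rewrite ltnn.
have inj : {in C &, injective lvl}.
  move=> c d cC dC e; have := Ccmp c d cC dC; case/orP; rewrite le_eqVlt.
    by case/orP=> [/eqP //|/lvl_lt]; rewrite e ltnn.
  by case/orP=> [/eqP //|/lvl_lt]; rewrite e ltnn.
have onto i : (i <= lvl x)%N -> exists2 c, c \in C & lvl c = i.
  move=> ix; have [/existsP[c /andP[cC /eqP]]|] :=
    boolP [exists c, (c \in C) && (lvl c == i)]; first by exists c.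
  rewrite negb_exists => /forallP no.
  have neq c : c \in C -> lvl c != i by move=> cC; have := no c; rewrite cC.
  have i0 : (0 < i)%N by rewrite lt0n eq_sym -lvl0 neq.
  have ix' : (i < lvl x)%N by rewrite ltn_neqAle eq_sym neq.
  (* If level [i] is missed, let [u] be the highest element of [C] under it and [v] the lowest above
     it. A point strictly between them is comparable with all of [C], hence lies in [C], against the
     choice of [u] or [v]. *)
  pose P c := (c \in C) && (lvl c < i)%N; pose R c := (c \in C) && (i < lvl c)%N.
  have Pb : P \bot by rewrite /P botC lvl0.
  have Rx : R x by rewrite /R xC.
  case: (@arg_maxnP _ \bot P lvl Pb) => u /andP[uC ui] umax.
  case: (@arg_minnP _ x R lvl Rx) => v /andP[vC iv] vmin.
  have [||z uz zv] := @lvl_dense u v.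
  - exact: lvlC (ltn_trans ui iv).
  - exact: leq_ltn_trans ui iv.
  have zC : z \in C.
    apply: add => [|c cC].
      by apply: le_trans (ltW zv) _; have := Cx v vC; rewrite inE.
    have [ci|ic|e] := ltngtP (lvl c) i.
    - have cu : (lvl c <= lvl u)%N by apply: umax; rewrite /P cC.
      rewrite /Order.comparable; apply/orP; right; apply: le_trans (ltW uz).
      have := Ccmp c u cC uC; case/orP=> //; rewrite le_eqVlt => /orP[/eqP -> //|/lvl_lt].
      by rewrite ltnNge cu.
    - have vc : (lvl v <= lvl c)%N by apply: vmin; rewrite /R cC.
      rewrite /Order.comparable; apply/orP; left; apply: le_trans (ltW zv) _.
      have := Ccmp v c vC cC; case/orP=> //; rewrite le_eqVlt => /orP[/eqP -> //|/lvl_lt].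
      by rewrite ltnNge vc.
    - by have := neq c cC; rewrite e eqxx.
  have := neq z zC; case: ltngtP => // [zi _|iz _].
  - by have := umax z; rewrite /P zC zi => /(_ isT) /= h; have := lvl_lt uz; rewrite ltnNge h.
  - by have := vmin z; rewrite /R zC iz => /(_ isT) h; have := lvl_lt zv; rewrite ltnNge h.
have lvlS c : c \in C -> (lvl c < (lvl x).+1)%N.
  move=> /Cx; rewrite inE le_eqVlt => /orP[/eqP->|/lvl_lt /ltnW] //.
rewrite -[RHS]card_ord -(card_in_imset (f := fun c => inord (lvl c) : 'I_(lvl x).+1)); last first.
  by move=> c d cC dC /(congr1 val); rewrite /= !inordK ?lvlS //; exact: inj.
rewrite -cardsT; apply: eq_card => i; rewrite inE; apply/imsetP.
have [|c cC ci] := onto i; first by rewrite -ltnS.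
by exists c => //; apply: val_inj; rewrite /= inordK ?lvlS.
Qed.

Lemma graded_ranked : ranked_poset G.
Proof. by move=> x C D /card_maxchain hC /card_maxchain hD; rewrite /chain_length hC hD. Qed.

Lemma graded_rank x : rank x = lvl x.
Proof.
rewrite /rank; have [|C CM _] := @maxset_exists _
    (fun D : {set G} => (D \subset below x) && chain D) set0.
  by rewrite sub0set; apply/forall_inP => a; rewrite inE.
apply/eqP; rewrite eqn_leq; apply/andP; split.
  by apply/bigmax_leqP => D /card_maxchain; rewrite /chain_length => ->.
apply: leq_trans (leq_bigmax_cond _ CM).
by rewrite /chain_length (card_maxchain CM).
Qed.

Lemma graded_layer x k y : (y \in layer x k) = (y <= x) && (lvl y + k == lvl x)%N.
Proof. by rewrite !inE !graded_rank. Qed.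

End GradedPoset.

Lemma equivalence_partition_full (T : finType) (R : rel T) (D : {set T}) x :
  x \in D -> {in D &, forall a b, R a b} -> #|equivalence_partition R D| = 1%N.
Proof.
move=> xD RD; suff -> : equivalence_partition R D = [set D] by rewrite cards1.
apply/setP=> B; rewrite inE; apply/imsetP/eqP => [[a aD ->]|->].
  by apply/setP=> b; rewrite inE; case: (boolP (b \in D)) => // bD; rewrite RD.
exists x => //; apply/setP=> b; rewrite inE.
by case: (boolP (b \in D)) => // bD; rewrite RD.
Qed.

(** * The poset *)

(* The letter gives the rank: A for atoms, then E, Y and W. *)
Variant pt := Bot | Aa | Aq | Ap | Ee | Ef1 | Ef2 | Eg1 | Eg2
  | Y1 | Y2 | Y3 | Y4 | W1 | W2 | Top.

Definition gens : seq pt :=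
  [:: Aa; Aq; Ap; Ee; Ef1; Ef2; Eg1; Eg2; Y1; Y2; Y3; Y4; W1; W2; Top].

Definition pts : seq pt := Bot :: gens.

Definition pt_code x : nat :=
  match x with
  | Bot => 0 | Aa => 1 | Aq => 2 | Ap => 3 | Ee => 4 | Ef1 => 5 | Ef2 => 6
  | Eg1 => 7 | Eg2 => 8 | Y1 => 9 | Y2 => 10 | Y3 => 11 | Y4 => 12 | W1 => 13
  | W2 => 14 | Top => 15
  end.

Lemma pt_codeK : cancel pt_code (nth Bot pts).
Proof. by case. Qed.

HB.instance Definition _ := Countable.copy pt (can_type pt_codeK).

Lemma pts_enum : Finite.axiom pts.
Proof. by case. Qed.

HB.instance Definition _ := isFinite.Build pt pts_enum.

Definition lower x : seq pt :=
  match x with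
  | Bot => [::]
  | Aa | Aq | Ap => [:: Bot]
  | Ee => [:: Aa]
  | Ef1 | Ef2 => [:: Aa; Aq]
  | Eg1 | Eg2 => [:: Aa; Ap]
  | Y1 => [:: Ee; Ef1]
  | Y2 => [:: Ee; Ef2]
  | Y3 => [:: Ef1; Ef2; Eg1]
  | Y4 => [:: Ef1; Ef2; Eg2]
  | W1 => [:: Y1; Y2; Y3]
  | W2 => [:: Y1; Y2; Y4]
  | Top => [:: W1; W2]
  end.

Definition lvl x : nat :=
  match x with
  | Bot => 0
  | Aa | Aq | Ap => 1
  | Ee | Ef1 | Ef2 | Eg1 | Eg2 => 2
  | Y1 | Y2 | Y3 | Y4 => 3
  | W1 | W2 => 4
  | Top => 5
  end.

Fixpoint downset n x : seq pt :=
  x :: (if n is n'.+1 then flatten (map (downset n') (lower x)) else [::]).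

(** Five steps down reach everything below [y], since [Top] has rank 5. *)
Definition pt_le x y : bool := x \in downset 5 y.

(** Reduces statements on the whole poset to checks over [pts] that [vm_compute] decides. *)
Lemma pt_all (P : pred pt) : all P pts -> forall x, P x.
Proof.
by rewrite /= !andbA andbT => h x; move: h; do 15! [case/andP]; case: x.
Qed.

Definition all_pts2 (P : pt -> pt -> bool) := all (fun x => all (P x) pts) pts.

Lemma pt_all2 P : all_pts2 P -> forall x y, P x y.
Proof. by move=> h x; apply: pt_all; move: x; exact: pt_all. Qed.

Lemma pt_le_refl : reflexive pt_le.
Proof. by apply: pt_all; vm_compute. Qed.

Lemma pt_le_anti : antisymmetric pt_le.
Proof.
move=> x y; have : (pt_le x y && pt_le y x) ==> (x == y).
  by move: x y; apply: pt_all2; vm_compute.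
by move/implyP => h /h/eqP.
Qed.

Lemma pt_le_trans : transitive pt_le.
Proof.
move=> y x z xy yz; have : all (fun t => pt_le x y && pt_le y t ==> pt_le x t) pts.
  by move: x y {xy yz}; apply: pt_all2; vm_compute.
by move/pt_all/(_ z); rewrite xy yz.
Qed.

Fact pt_display : Order.disp_t. Proof. exact: Order.Disp tt tt. Qed.

HB.instance Definition _ :=
  Order.Le_isPOrder.Build pt_display pt pt_le_refl pt_le_anti pt_le_trans.

Lemma pt_le0 x : pt_le Bot x.
Proof. by move: x; apply: pt_all; vm_compute. Qed.

HB.instance Definition _ := Order.hasBottom.Build pt_display pt pt_le0.

Local Notation pposet := (pt : finBPOrderType pt_display).

Lemma lvl_lt (x y : pposet) : (x < y)%O -> (lvl x < lvl y)%N.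
Proof.
rewrite lt_neqAle; apply/implyP; move: x y; apply: pt_all2; by vm_compute.
Qed.

Lemma lvl_dense (x y : pposet) : (x < y)%O -> ((lvl x).+1 < lvl y)%N ->
  exists2 z, (x < z)%O & (z < y)%O.
Proof.
rewrite lt_neqAle => xy xy2.
have /implyP := pt_all2 (P := fun x y => [&& x != y, pt_le x y & ((lvl x).+1 < lvl y)%N] ==>
  has (fun z => [&& x != z, pt_le x z, z != y & pt_le z y]) pts) isT x y.
case/andP: xy => -> xy; rewrite xy2 [pt_le x y]xy => /(_ isT).
case/hasP=> z _ /and4P[xz xz' zy zy'].
by exists z; rewrite lt_neqAle ?xz ?zy.
Qed.

(** A form of [layer] that computes; [pt_layer] identifies the two. *)
Definition cov k x y := pt_le y x && (lvl y + k == lvl x)%N.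

Lemma pt_layer (x y : pposet) k : (y \in layer x k) = cov k x y.
Proof. exact: (graded_layer (erefl : lvl \bot%O = 0%N) lvl_lt lvl_dense). Qed.

Lemma pt_ranked : ranked_poset pposet.
Proof. exact: (graded_ranked (erefl : lvl \bot%O = 0%N) lvl_lt lvl_dense). Qed.

Lemma pt_cyclic : cyclic_poset pposet.
Proof.
exists Top; apply/setP=> x; rewrite !inE.
by move: x; apply: pt_all; vm_compute.
Qed.

(** Checked by enumeration. It makes any two elements of S_x(1) of positive rank adjacent, and it
    later provides the confluence property [covX_meet]. *)
Lemma common_cover x y : lvl x = lvl y -> (0 < lvl x)%N ->
  exists2 z, cov 1 x z & cov 1 y z.
Proof.
move=> e h.
have /implyP := pt_all2 (P := fun x y => (lvl x == lvl y) && (0 < lvl x)%N ==>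
  has (fun z => cov 1 x z && cov 1 y z) pts) isT x y.
rewrite h e eqxx => /(_ isT)/hasP[z _ /andP[]]; by exists z.
Qed.

Lemma pt_uniform : uniform_poset pposet.
Proof.
move=> x x0.
have /hasP[y _ xy] : has (cov 1 x) pts.
  have : (x != Bot) ==> has (cov 1 x) pts by move: x {x0}; apply: pt_all; vm_compute.
  by move/implyP; apply.
apply: (@equivalence_partition_full _ _ _ y) => [|a b]; first by rewrite pt_layer.
move=> la lb; move: (la) (lb); rewrite !pt_layer.
case/andP=> [_ /eqP ha] /andP[_ /eqP hb].
have e : lvl a = lvl b by lia.
have [l1|l1] := ltnP 0 (lvl a).
  have [z za zb] := common_cover e l1.
  apply: connect1; rewrite /adjacent /= la lb; apply/set0Pn; exists z.
  by rewrite inE !pt_layer za.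
(* Here [x] has rank 1, and S_x(1) contains only [Bot]. *)
suff -> : a = b by exact: connect0.
have bot0 c : lvl c = 0%N -> c = Bot by case: c.
by rewrite (bot0 a) 1?(bot0 b) //; lia.
Qed.

(** * Normal forms in the quadratic dual *)

Section Words.
Variable X : finType.
Implicit Types (m s t : seq X) (x y z : X).

Fixpoint words n : seq (seq X) :=
  if n is n'.+1 then [seq x :: m | x <- enum X, m <- words n'] else [:: [::]].

Lemma mem_words n m : (m \in words n) = (size m == n).
Proof.
elim: n m => [|n IHn] [|x m] //=; first by apply/negbTE/allpairsP => -[[y m] [_ _]].
rewrite eqSS -IHn; apply/allpairsP/idP => [[[y m'] [_ hm [_ ->]]] //|hm].
by exists (x, m); rewrite mem_enum.
Qed.

Lemma words_uniq n : uniq (words n).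
Proof.
elim: n => //= n IHn; apply: allpairs_uniq => //; first exact: enum_uniq.
by move=> [x m] [y m'] _ _ [-> ->].
Qed.

Lemma count_words n (P : pred (seq X)) :
  count P (words n.+1) = (\sum_x count (fun m => P (x :: m)) (words n))%N.
Proof.
rewrite /= count_flatten -map_comp sumnE big_map big_enum /=.
by apply: eq_bigr => x _; rewrite count_map.
Qed.

(* [cov k x y] stands for y \in S_x(k); in the monoid with the relations
   x y = x y' for y, y' \in S_x(1), every word is equal to one in which each
   maximal descending run from x is x, next x, next (next x), ... *)
Variables (cov : nat -> rel X) (next : X -> X).

(** The state [(x, k)] records the head of the current run and the number of steps already made
    below it. Whether a letter continues the run is tested against the head, not against the
    previous letter. *)
Fixpoint nf_from (st : X * nat) m : seq X :=
  if m is z :: m' then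
    if cov st.2.+1 st.1 z
    then iter st.2.+1 next st.1 :: nf_from (st.1, st.2.+1) m'
    else z :: nf_from (z, 0%N) m'
  else [::].

Definition nf m : seq X := if m is z :: m' then z :: nf_from (z, 0%N) m' else [::].

Lemma size_nf_from st m : size (nf_from st m) = size m.
Proof. by elim: m st => //= z m IHm st; case: ifP => _ /=; rewrite IHm. Qed.

Lemma size_nf m : size (nf m) = size m.
Proof. by case: m => //= z m; rewrite size_nf_from. Qed.

Hypothesis covM : forall k x y z, cov k x y -> cov 1 y z -> cov k.+1 x z.
Hypothesis cov_next : forall k x z, cov k.+1 x z ->
  cov k.+1 x (iter k.+1 next x) /\ cov 1 (iter k next x) (iter k.+1 next x).
Hypothesis cov_split : forall k x z, cov k.+2 x z ->
  exists2 y, cov k.+1 x y & cov 1 y z.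
Hypothesis cov_meet : forall k x y y' z, cov k x y -> cov k x y' -> cov 1 y z ->
  exists2 z', cov 1 y z' & cov 1 y' z'.

Lemma nf_from_idem st m : nf_from st (nf_from st m) = nf_from st m.
Proof.
elim: m st => //= z m IHm st; case: ifP => h /=; last by rewrite h IHm.
by have [/= -> _] := cov_next h; rewrite IHm.
Qed.

Lemma nf_idem m : nf (nf m) = nf m.
Proof. by case: m => //= z m; rewrite nf_from_idem. Qed.

(** Whether [x] continues a run ([covM]) or starts one, both [y] and [y'] continue it; they give the
    same output letter and leave the same state. *)
Lemma nf_from_rel st s x y y' t : cov 1 x y -> cov 1 x y' ->
  nf_from st (s ++ x :: y :: t) = nf_from st (s ++ x :: y' :: t).
Proof.
move=> xy xy'; elim: s st => [|z s IHs] st /=; last by rewrite !IHs.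
by case: ifP => h; [rewrite !(covM h) | rewrite xy xy'].
Qed.

Lemma nf_rel s x y y' t : cov 1 x y -> cov 1 x y' ->
  nf (s ++ x :: y :: t) = nf (s ++ x :: y' :: t).
Proof.
move=> xy xy'; case: s => [|z s] /=; first by rewrite xy xy'.
by rewrite (nf_from_rel _ _ _ xy xy').
Qed.

Section Invariant.
Variables (T : Type) (phi : seq X -> T).
Hypothesis phi_rel : forall s x y y' t, cov 1 x y -> cov 1 x y' ->
  phi (s ++ x :: y :: t) = phi (s ++ x :: y' :: t).

(** Induction on the length of the run. With [y] between [x] and [z] and [c] the last letter of the
    run, the induction hypothesis replaces [c] by [y]; then [z] becomes a common lower cover [z'] of
    [y] and [c], [y] is turned back into [c], and [z'] becomes the prescribed letter. *)
Lemma phi_run k x z s t : cov k.+1 x z ->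
  phi (s ++ traject next x k.+1 ++ z :: t) =
  phi (s ++ traject next x k.+1 ++ iter k.+1 next x :: t).
Proof.
elim: k z t => [|k IHk] z t xz; have [xn nn] := cov_next xz.
  exact: phi_rel.
have [y xy yz] := cov_split xz.
have [xc _] := cov_next xy; set c := iter k.+1 next x in IHk xc nn *.
have [z' yz' cz'] := cov_meet xy xc yz.
rewrite [traject _ _ k.+2]trajectSr -/c !cat_rcons -(IHk y) //.
have := phi_rel (s ++ traject next x k.+1) t yz yz'; rewrite -!catA => ->.
rewrite (IHk y) //.
have := phi_rel (s ++ traject next x k.+1) t cz' nn; rewrite -!catA => ->.
by [].
Qed.

Lemma phi_nf_from k x m s :
  phi (s ++ traject next x k.+1 ++ m) =
  phi (s ++ traject next x k.+1 ++ nf_from (x, k) m).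
Proof.
elim: m k x s => [//|z m IHm] k x s; rewrite [nf_from _ _]/=.
case: ifP => xz; last first.
  by have := IHm 0%N z (s ++ traject next x k.+1); rewrite -!catA.
rewrite phi_run //; have := IHm k.+1 x s.
by rewrite [traject _ _ k.+2]trajectSr !cat_rcons.
Qed.

(** With [phi] the class of a word in the quadratic dual, this shows that the normal words span
    it. *)
Lemma phi_nf m : phi m = phi (nf m).
Proof. by case: m => //= z m; exact: (phi_nf_from 0 z m [::]). Qed.

End Invariant.

Definition num_normal_from n st := count (fun m => nf_from st m == m) (words n).
Definition num_normal n := count (fun m => nf m == m) (words n).

Lemma num_normalS n : num_normal n.+1 = (\sum_x num_normal_from n (x, 0%N))%N.
Proof.
rewrite /num_normal count_words; apply: eq_bigr => x _; apply: eq_count => m /=.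
by rewrite eqseq_cons eqxx.
Qed.

(** The first letter of a normal continuation is either the prescribed element of S_x(k+1), if this
    set is nonempty, or a letter outside S_x(k+1), which starts a new run. The latter are counted as
    all normal words minus those that begin in S_x(k+1). *)
Lemma num_normal_fromS n x k : (num_normal_from n.+1 (x, k))%:Z =
  [exists z, cov k.+1 x z]%:R * (num_normal_from n (x, k.+1))%:Z + (num_normal n.+1)%:Z
  - \sum_(z | cov k.+1 x z) (num_normal_from n (z, 0%N))%:Z.
Proof.
rewrite num_normalS (big_morph Posz PoszD (erefl _)) -addrA.
rewrite [X in _ + (X - _)](bigID (cov k.+1 x)) /= addrAC subrr add0r.
rewrite {1}/num_normal_from count_words (big_morph Posz PoszD (erefl _)).
rewrite (bigID (cov k.+1 x)) /=; congr (_ + _); last first.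
  apply: eq_bigr => z /negbTE xz; congr Posz; apply: eq_count => m.
  by rewrite xz eqseq_cons eqxx.
have [/existsP[z /cov_next[xc _]]|] := boolP [exists z, cov k.+1 x z]; last first.
  rewrite negb_exists => /forallP h; rewrite mul0r big_pred0 // => z.
  exact/negbTE.
rewrite mul1r (bigD1 (iter k.+1 next x)) //= big1 => [|y /andP[xy yc]].
  rewrite addr0; congr Posz; apply: eq_count => m.
  by rewrite xc eqseq_cons eqxx.
apply/eqP; rewrite eqz_nat -leqn0 leqNgt -has_count; apply/hasPn => m _.
by rewrite xy eqseq_cons eq_sym (negPf yc).
Qed.

(* The recursion num_normal_fromS unrolled: the number of normal continuations
   of length n of a run of k steps below x is the sum over j of
   [run_coef j x k] times the number of normal words of length n - j. *)
Fixpoint run_coef j x k : int :=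
  if j is j'.+1 then
    [exists z, cov k.+1 x z]%:R * run_coef j' x k.+1
    - \sum_(z | cov k.+1 x z) run_coef j' z 0%N
  else 1.

Lemma num_normal_from_coef n x k :
  (num_normal_from n (x, k))%:Z = \sum_(j < n.+1) run_coef j x k * (num_normal (n - j))%:Z.
Proof.
elim: n x k => [|n IHn] x k; first by rewrite big_ord1.
rewrite num_normal_fromS IHn [RHS]big_ord_recl /= mul1r subn0 mulr_sumr.
under [X in _ - X]eq_bigr => z _ do rewrite IHn.
rewrite exchange_big /= addrAC addrC; congr (_ + _).
rewrite -sumrB; apply: eq_bigr => j _.
by rewrite subSS mulrBl -mulrA -mulr_suml.
Qed.

(** In terms of generating series: the series of [num_normal] is the inverse of 1 minus the sum over
    j and x of [run_coef j x 0] t^(j+1). *)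
Lemma num_normal_rec n :
  (num_normal n.+1)%:Z = \sum_(j < n.+1) (\sum_x run_coef j x 0) * (num_normal (n - j))%:Z.
Proof.
rewrite num_normalS (big_morph Posz PoszD (erefl _)).
under eq_bigr => x _ do rewrite num_normal_from_coef.
by rewrite exchange_big /=; apply: eq_bigr => j _; rewrite mulr_suml.
Qed.

End Words.

(** * Normal words for the poset and numerical Koszulness *)

Local Notation X := (nonbottom pposet).
Section CoveringRelation.
Implicit Types (x y z : X).

(** [gen Bot] is the default value [Top], whence the conditions [a != Bot] in what follows. *)
Definition gen (a : pt) : X := insubd (Sub Top isT : X) a.

Lemma val_gen a : a != Bot -> val (gen a) = a.
Proof. by move=> a0; rewrite val_insubd a0. Qed.

Lemma genK x : gen (val x) = x.
Proof. exact: valKd. Qed.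

Lemma gen_lvl (a : pt) : (0 < lvl a)%N -> val (gen a) = a.
Proof. by move=> h; apply: val_gen; case: a h. Qed.

Lemma lvl_gt0 x : (0 < lvl (val x))%N.
Proof. by case: x => -[]. Qed.

Lemma big_gens (V : nmodType) (P : pred pt) (h : pt -> V) :
  \sum_(z : X | P (val z)) h (val z) = \sum_(z <- gens | P z) h z.
Proof.
rewrite -(big_map val P h); apply: perm_big.
apply: uniq_perm => [||a]; first by rewrite map_inj_uniq ?index_enum_uniq //; exact: val_inj.
  by [].
apply/mapP/idP => [[x _ ->]|]; first by case: x => -[].
by move=> ag; exists (gen a); rewrite ?mem_index_enum ?val_gen //; case: a ag.
Qed.

Definition covX k x y := cov k (val x) (val y).

(** A choice of an element of S_a(1); on [Bot] and on the atoms the value is junk. *)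
Definition next0 (a : pt) : pt :=
  match a with
  | Top => W1 | W1 | W2 => Y1 | Y2 => Ef2 | Y1 | Y3 | Y4 => Ef1 | _ => Aa
  end.

Definition next x : X := gen (next0 (val x)).

Lemma val_next k x : val (iter k next x) = iter k next0 (val x).
Proof.
by elim: k => //= k <-; rewrite val_gen //; case: (val _).
Qed.

Lemma cov_lvl k x y : covX k x y -> (lvl (val y) + k = lvl (val x))%N.
Proof. by case/andP=> _ /eqP. Qed.

Lemma covX_M k x y z : covX k x y -> covX 1 y z -> covX k.+1 x z.
Proof.
case/andP=> yx /eqP h /andP[zy /eqP h']; rewrite /covX /cov (pt_le_trans zy yx) /=.
by rewrite -h -h' -addnA add1n.
Qed.

(** Bounds [k], so that the properties of [covX] become finite checks. *)
Lemma cov_bound k x y : covX k x y -> (k < 5)%N.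
Proof.
move/cov_lvl; have := lvl_gt0 y; have : (lvl (val x) <= 5)%N by case: (val x).
by lia.
Qed.

Lemma covX_next k x z : covX k.+1 x z ->
  covX k.+1 x (iter k.+1 next x) /\ covX 1 (iter k next x) (iter k.+1 next x).
Proof.
move=> xz; have := cov_bound xz; move: xz; rewrite /covX !val_next => xz k5.
have := pt_all2 (P := fun a b => all (fun k => (b != Bot) && cov k.+1 a b ==>
  cov k.+1 a (iter k.+1 next0 a) && cov 1 (iter k next0 a) (iter k.+1 next0 a))
  (iota 0 5)) isT (val x) (val z).
move/allP/(_ k); rewrite mem_iota add0n (ltnW k5) => /(_ isT)/implyP.
by rewrite xz andbT => /(_ (valP z))/andP.
Qed.

Lemma covX_split k x z : covX k.+2 x z -> exists2 y, covX k.+1 x y & covX 1 y z.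
Proof.
move=> xz; have := cov_bound xz; move: xz; rewrite /covX => xz k5.
have := pt_all2 (P := fun a b => all (fun k => cov k.+2 a b ==>
  has (fun c => cov k.+1 a c && cov 1 c b) gens)
  (iota 0 5)) isT (val x) (val z).
move/allP/(_ k); rewrite mem_iota add0n.
move: (k5) => /ltnW/ltnW -> /(_ isT)/implyP/(_ xz)/hasP[c cg /andP[xc cz]].
by exists (gen c); rewrite val_gen //; case: c cg {xc cz}.
Qed.

Lemma covX_meet k x y y' z : covX k x y -> covX k x y' -> covX 1 y z ->
  exists2 z', covX 1 y z' & covX 1 y' z'.
Proof.
move=> /cov_lvl xy /cov_lvl xy' /cov_lvl yz; have := lvl_gt0 z => z0.
have [||c yc y'c] := @common_cover (val y) (val y'); [by lia..|].
have c0 : (0 < lvl c)%N by case/andP: yc => _ /eqP; lia.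
by exists (gen c); rewrite /covX gen_lvl.
Qed.

(** A copy of [run_coef] on the concrete list of points, with [foldr] in place of the big operator,
    so that it evaluates. *)
Fixpoint pt_coef j (a : pt) k : int :=
  if j is j'.+1 then
    (has (cov k.+1 a) gens)%:R * pt_coef j' a k.+1
    - foldr (fun b r => (if cov k.+1 a b then pt_coef j' b 0 else 0) + r) 0 gens
  else 1.

Lemma pt_coefS j (a : pt) k : pt_coef j.+1 a k =
  (has (cov k.+1 a) gens)%:R * pt_coef j a k.+1
  - \sum_(b <- gens | cov k.+1 a b) pt_coef j b 0.
Proof. by rewrite big_mkcond unlock. Qed.

Lemma run_coef_pt j x k : run_coef covX j x k = pt_coef j (val x) k.
Proof.
elim: j x k => [//|j IHj] x k; rewrite pt_coefS [LHS]/= IHj; congr (_%:R * _ - _).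
  congr nat_of_bool; apply/existsP/hasP => [[z xz]|[a ag xa]].
    by exists (val z) => //; case: z {xz} => -[].
  by exists (gen a); rewrite /covX val_gen //; case: a ag {xa}.
under eq_bigr => z _ do rewrite IHj.
exact: (big_gens (cov k.+1 (val x)) (fun a => pt_coef j a 0)).
Qed.

Definition rdim n : nat := nth 0%N [:: 1; 15; 15; 5]%N n.

Lemma pt_coef_ge5 j a k : (5 <= j)%N -> pt_coef j a k = 0.
Proof.
elim: j a k => // j IHj a k; rewrite ltnS leq_eqVlt => /orP[/eqP <-|j5].
  have [k5|k5] := ltnP k 5.
    have h : all (fun a => all (fun k => pt_coef 5 a k == 0) (iota 0 5)) pts.
      by vm_compute.
    by have := pt_all h a; move/allP/(_ k); rewrite mem_iota => /(_ k5)/eqP.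
  (* For [k] at least 5 no point lies [k + 1] ranks below another, which leaves an empty sum. *)
  have nocov b : cov k.+1 a b = false.
    apply/negbTE/negP => /andP[_ /eqP]; have : (lvl a <= 5)%N by case: a.
    by lia.
  rewrite pt_coefS big_pred0 // (eq_has nocov) has_pred0.
  by rewrite mul0r subr0.
by rewrite pt_coefS IHj // mulr0 big1 ?subr0 // => b _; exact: IHj.
Qed.

(** Up to sign, [run_coef j x 0] is the reduced Euler characteristic of the [j] ranks just below
    [x]. For [j = 4] only [Top] can contribute, and the value 0 reflects h^1 = h^2. *)
Lemma run_coef_sum j : \sum_x run_coef covX j x 0 = (-1) ^+ j * (rdim j.+1)%:Z.
Proof.
under eq_bigr => x _ do rewrite run_coef_pt.
rewrite (big_gens predT (fun a => pt_coef j a 0)).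
have [j5|j5] := leqP 5 j.
  rewrite big1 => [|a _]; last exact: pt_coef_ge5.
  rewrite /rdim nth_default; first by rewrite [RHS]mulr0.
  exact: leqW (ltnW j5).
rewrite unlock; case: j j5 => [|[|[|[|[|//]]]]] _; vm_compute; reflexivity.
Qed.

Definition dual_dim := num_normal covX next.

Lemma koszul_numerics n :
  \sum_(i < n.+1) (-1) ^+ i * (rdim i)%:Z * (dual_dim (n - i))%:Z = (n == 0%N)%:Z.
Proof.
case: n => [|n]; first by rewrite big_ord1.
rewrite big_ord_recl subn0 [X in X + _]mul1r /dual_dim (num_normal_rec covX_next).
rewrite -big_split big1 //= => i _.
by rewrite run_coef_sum subSS exprS !mulN1r !mulNr subrr.
Qed.

(** * The basis of normal words in the quadratic dual *)

Section Dual.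
Variable F : fieldType.
Local Notation rel := (@poset_rel F pt_display pposet).
Local Notation drel := (quad_orth rel).

(** The difference of the basis tensors at [(x, y)] and [(x, y')] is orthogonal to both kinds of
    relations of R_G. *)
Lemma dual_qword s x y y' t : covX 1 x y -> covX 1 x y' ->
  qword drel (s ++ x :: y :: t) = qword drel (s ++ x :: y' :: t).
Proof.
move=> xy xy'; suff e : qword drel [:: x; y] = qword drel [:: x; y'].
  rewrite (qword_cat _ s (x :: y :: t)) (qword_cat _ s (x :: y' :: t)).
  by rewrite (qword_cat _ [:: x; y] t) (qword_cat _ [:: x; y'] t) e.
apply/eqP; rewrite -subr_eq0; apply/eqP.
pose q : tensor2 F X := [ffun p => (p == (x, y))%:R - (p == (x, y'))%:R].
have sumq (V : lmodType F) (h : X * X -> V) :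
    \sum_p q p *: h p = h (x, y) - h (x, y').
  under eq_bigr => p _ do rewrite ffunE scalerBl.
  rewrite sumrB (bigD1 (x, y)) //= eqxx scale1r big1 => [|p /negbTE ->]; last first.
    by rewrite scale0r.
  rewrite (bigD1 (x, y')) //= eqxx scale1r big1 ?addr0 // => p /negbTE ->.
  by rewrite scale0r.
have qQ : drel q.
  move=> r; case=> [x0 y0 n0|x0]; rewrite (sumq F^o) !ffunE /=.
    rewrite !xpair_eqE.
    suff n1 w : covX 1 x w -> (x == x0) && (w == y0) = false.
      by rewrite !n1 // subrr.
    move=> xw; apply/negP => /andP[/eqP ex /eqP ew].
    by move: n0; rewrite pt_layer -ex -ew -/(covX 1 x w) xw.
  by rewrite !pt_layer; move: xy xy'; rewrite /covX; have [<- -> ->|] := eqVneq x x0; rewrite subrr.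
by rewrite -[RHS](quad_rel_word qQ) sumq.
Qed.

(** An element [g] of [quad_orth] vanishes at [(x, y)] unless y is in S_x(1), and for each [x] its
    values over S_x(1) sum to zero. A function constant along S_x(1) therefore kills it. *)
Lemma dual_annihilates (c : seq X -> F) :
    (forall s x y y' t, covX 1 x y -> covX 1 x y' ->
       c (s ++ x :: y :: t) = c (s ++ x :: y' :: t)) ->
  annihilates drel c.
Proof.
move=> cinv s t g gQ.
transitivity (\sum_x \sum_y g (x, y) * c (s ++ x :: y :: t)).
  by rewrite pair_bigA; apply: eq_bigr => -[].
apply: big1 => x _.
have g0 y : ~~ covX 1 x y -> g (x, y) = 0.
  move=> xy; have := gQ _ (@poset_rel_mul F _ pposet x y _).
  rewrite pt_layer => /(_ xy); rewrite (bigD1 (x, y)) //= ffunE eqxx mulr1.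
  rewrite big1 ?addr0 // => p /negbTE pn; by rewrite ffunE pn mulr0.
have gs : \sum_(y | covX 1 x y) g (x, y) = 0.
  rewrite -[RHS](gQ _ (@poset_rel_sum F _ pposet x)); set r := finfun _.
  transitivity (\sum_x' \sum_y g (x', y) * r (x', y)); last first.
    by rewrite pair_bigA; apply: eq_bigr => -[].
  rewrite [RHS](bigD1 x) //= {}/r.
  rewrite [X in _ = _ + X]big1 ?addr0 => [|x' /negbTE xx']; last first.
    by apply: big1 => y _; rewrite ffunE /= xx' mulr0.
  rewrite big_mkcond; apply: eq_bigr => y _; rewrite ffunE /= eqxx pt_layer.
  by rewrite -/(covX 1 x y); case: ifP; rewrite ?mulr1 ?mulr0.
rewrite (bigID (covX 1 x)) /= [X in _ + X]big1 ?addr0 => [|y /g0 ->]; last by rewrite mul0r.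
have [y xy|no] := pickP (covX 1 x); last by rewrite big_pred0.
rewrite (eq_bigr (fun z => g (x, z) * c (s ++ x :: y :: t))) => [|z xz].
  by rewrite -mulr_suml gs mul0r.
by congr (_ * _); exact: cinv.
Qed.

(** The form dual to a normal word [v] is the indicator of the words with normal form [v]. *)
Lemma dual_hilbert : hilbert_series (quad_grade (Q := drel)) dual_dim.
Proof.
move=> n; rewrite /dual_dim /num_normal -size_filter.
set N := filter _ _; have uN : uniq N by rewrite filter_uniq ?words_uniq.
apply: (@quad_has_dim _ _ _ _ _ (fun v s => (nf covX next s == v)%:R)) => //.
- by move=> t; rewrite mem_filter mem_words => /andP[_ /eqP].
- move=> t _; apply: dual_annihilates => s x y y' u xy xy'.
  by rewrite (nf_rel next covX_M _ _ xy xy').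
- move=> t s _; rewrite mem_filter => /andP[/eqP -> _]; by rewrite eq_sym.
- move=> s ss; have nN : nf covX next s \in N.
    by rewrite mem_filter (nf_idem covX_next) eqxx mem_words size_nf ss eqxx.
  rewrite (bigD1_seq _ nN uN) /= eqxx scale1r big1 ?addr0 => [|v vn].
    by rewrite -(phi_nf covX_next covX_split covX_meet dual_qword).
  by rewrite eq_sym (negPf vn) scale0r.
Qed.

End Dual.

End CoveringRelation.

(** * The Hilbert series of the poset algebra *)

Definition nlower (a : pt) : seq pt := [seq b <- lower a | b != Bot].

Lemma nlower_filter a : [seq b <- gens | cov 1 a b] = nlower a.
Proof.
apply/eqP; move: a; apply: pt_all; by vm_compute.
Qed.

Lemma mem_nlower a b : (b \in nlower a) = (b != Bot) && cov 1 a b.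
Proof.
rewrite -nlower_filter mem_filter andbC; congr (_ && _).
by case: b.
Qed.

Lemma covX1 (x y : X) : covX 1 x y = (val y \in nlower (val x)).
Proof. by rewrite mem_nlower (valP y). Qed.

Lemma mem_gens a : (a \in gens) = (a != Bot).
Proof. by case: a. Qed.

(** A sum that unfolds by conversion on concrete lists. *)
Definition psum (V : nmodType) (f : pt -> V) (s : seq pt) : V :=
  foldr (fun b r => f b + r) 0 s.

Lemma psumE (V : nmodType) (f : pt -> V) s : psum f s = \sum_(b <- s) f b.
Proof. by rewrite unlock. Qed.

(** The integral version of [annihilates]: a single computation over the integers then serves every
    field. *)
Definition annih (C : seq pt -> int) : Prop :=
  (forall s a b t, b \notin nlower a -> C (s ++ a :: b :: t) = 0) /\
  (forall s a t, psum (fun b => C (s ++ a :: b :: t)) (nlower a) = 0).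

Definition deg1 (l : pt -> int) (s : seq pt) : int :=
  if s is [:: a] then l a else 0.
Definition deg2 (l : pt -> pt -> int) (s : seq pt) : int :=
  if s is [:: a; b] then l a b else 0.
Definition deg3 (l : pt -> pt -> pt -> int) (s : seq pt) : int :=
  if s is [:: a; b; c] then l a b c else 0.

Definition check2 (l : pt -> pt -> int) :=
  all_pts2 (fun a b => (b \in nlower a) || (l a b == 0)) &&
  all (fun a => psum (l a) (nlower a) == 0) pts.

Definition check3 (l : pt -> pt -> pt -> int) :=
  [&& all_pts2 (fun a b => (b \in nlower a) || all (fun c => l a b c == 0) pts),
      all_pts2 (fun b c => (c \in nlower b) || all (fun a => l a b c == 0) pts),
      all_pts2 (fun a c => psum (fun b => l a b c) (nlower a) == 0) &
      all_pts2 (fun a b => psum (l a b) (nlower b) == 0)].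

Lemma psum0 (V : nmodType) (s : seq pt) : psum (fun=> 0 : V) s = 0.
Proof. by rewrite psumE big1. Qed.

Lemma annih_deg1 l : annih (deg1 l).
Proof.
by split=> [[|? [|? ?]]|[|? [|? ?]] a t] //; exact: psum0.
Qed.

Lemma annih_deg2 l : check2 l -> annih (deg2 l).
Proof.
case/andP=> h0 hs; split=> [[|c [|d [|e s]]] a b [|f t] hb|[|c [|d [|e s]]] a [|f t]] //;
  try exact: psum0.
  by have := pt_all2 h0 a b; rewrite (negPf hb) => /eqP.
by have /eqP := pt_all hs a.
Qed.

Lemma annih_deg3 l : check3 l -> annih (deg3 l).
Proof.
case/and4P=> h01 h12 hs1 hs2.
split=> [[|c [|d [|e [|i s]]]] a b [|f [|g t]] hb|[|c [|d [|e [|i s]]]] a [|f [|g t]]] //;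
  try exact: psum0.
- by have := pt_all2 h01 a b; rewrite (negPf hb) => /pt_all/(_ f)/eqP.
- by have := pt_all2 h12 a b; rewrite (negPf hb) => /pt_all/(_ c)/eqP.
- by have /eqP := pt_all2 hs1 a f.
- by have /eqP := pt_all2 hs2 c a.
Qed.

(** * Integral forms and words in the poset algebra *)

Section PosetAlg.
Variable F : fieldType.
Local Notation rel := (@poset_rel F pt_display pposet).
Local Notation A := (quad_alg rel).

Definition weight (C : seq pt -> int) (s : seq X) : F := (C (map val s))%:~R.

Lemma weight_annihilates C : annih C -> annihilates rel (weight C).
Proof.
case=> C0 CS s t q; case=> [x y|x].
  rewrite pt_layer -/(covX 1 x y) covX1 => xy; rewrite (bigD1 (x, y)) //= big1.
    by rewrite ffunE eqxx mul1r addr0 /weight map_cat /= C0.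
  by move=> p /negbTE pn; rewrite ffunE pn mul0r.
transitivity (\sum_(y | covX 1 x y) weight C (s ++ x :: y :: t)).
  transitivity (\sum_x' \sum_y (((x' == x) && covX 1 x y)%:R : F) * weight C (s ++ x' :: y :: t)).
    rewrite pair_bigA; apply: eq_bigr => -[x' y] _; rewrite ffunE /= pt_layer -/(covX 1 x y).
    by [].
  rewrite [LHS](bigD1 x) //= [X in _ + X]big1 ?addr0 => [|x' /negbTE ->]; last first.
    by apply: big1 => y _; rewrite mul0r.
  rewrite [RHS]big_mkcond; apply: eq_bigr => y _; rewrite eqxx.
  by case: ifP => _; rewrite ?mul1r ?mul0r.
rewrite /weight (eq_bigr (fun y : X => (C (map val s ++ val x :: val y :: map val t))%:~R)); last first.
  by move=> y _; rewrite map_cat.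
rewrite (big_gens (cov 1 (val x)) (fun b => (C (map val s ++ val x :: b :: map val t))%:~R)).
by rewrite -big_filter nlower_filter -rmorph_sum /= -psumE CS.
Qed.

Definition pword (s : seq pt) : A := qword rel (map gen s).

Lemma pword_cat s t : pword (s ++ t) = pword s * pword t.
Proof. by rewrite /pword map_cat qword_cat. Qed.

Lemma pword_cons a s : pword (a :: s) = pword [:: a] * pword s.
Proof. by rewrite -pword_cat. Qed.

Lemma pword_rel0 a b : a != Bot -> b != Bot -> b \notin nlower a -> pword [:: a; b] = 0.
Proof.
move=> a0 b0 ab; have := @poset_rel_mul F _ pposet (gen a) (gen b).
rewrite pt_layer !val_gen //; have nc : ~~ cov 1 a b by move: ab; rewrite mem_nlower b0.
move=> /(_ nc)/quad_rel_word; rewrite (bigD1 (gen a, gen b)) //= big1 => [|p /negbTE pn].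
  by rewrite addr0 ffunE eqxx scale1r.
by rewrite ffunE pn scale0r.
Qed.

Lemma pword_relS a : a != Bot -> psum (fun b => pword [:: a; b]) (nlower a) = 0.
Proof.
move=> a0; rewrite -[RHS](quad_rel_word (@poset_rel_sum F _ pposet (gen a))).
transitivity (\sum_x' \sum_y (((x' == gen a) && cov 1 a (val y))%:R : F) *: qword rel [:: x'; y]);
  last first.
  rewrite pair_bigA; apply: eq_bigr => -[x' y] _; rewrite ffunE /= pt_layer.
  by rewrite val_gen.
rewrite [RHS](bigD1 (gen a)) //= [X in _ = _ + X]big1 ?addr0 => [|x' /negbTE ->]; last first.
  by apply: big1 => y _; rewrite scale0r.
rewrite psumE -nlower_filter big_filter -(big_gens (cov 1 a) (fun b => pword [:: a; b])).
rewrite big_mkcond; apply: eq_bigr => y _; rewrite eqxx /pword /= genK.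
by case: ifP => _; rewrite ?scale1r ?scale0r.
Qed.

Lemma pt_has_dim n (N : seq (seq pt)) (C : seq pt -> seq pt -> int) :
    uniq N -> all (all (fun a => a != Bot)) N -> all (fun v => size v == n) N ->
    (forall v, v \in N -> annih (C v)) ->
    all (fun v => all (fun w => C v w == (v == w)) N) N ->
    (forall s, all (fun a => a != Bot) s -> size s = n ->
       pword s = \sum_(v <- N) (C v s)%:~R *: pword v) ->
  has_dim (quad_grade (Q := rel) n) (size N).
Proof.
move=> uN bN sN aN cN wE; rewrite -(size_map (map gen)).
have valK v : v \in N -> map val (map gen v) = v.
  move=> vN; rewrite -map_comp -[RHS]map_id; apply/eq_in_map => a av /=.
  by rewrite val_gen //; exact: (allP (allP bN v vN)).
apply: (@quad_has_dim _ _ _ _ _ (fun v => weight (C (map val v)))).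
- rewrite map_inj_in_uniq // => v w vN wN e.
  by rewrite -(valK v) // e valK.
- by move=> _ /mapP[v vN ->]; rewrite size_map; apply/eqP; exact: (allP sN).
- by move=> _ /mapP[v vN ->]; rewrite valK //; apply: weight_annihilates; exact: aN.
- move=> _ _ /mapP[v vN ->] /mapP[w wN ->]; rewrite /weight !valK //.
  rewrite (eqP (allP (allP cN v vN) w wN)) (_ : (v == w) = (map gen v == map gen w)).
    by case: (_ == _).
  by apply/eqP/eqP => [->//|e]; rewrite -(valK v) // e valK.
- move=> s ss; have sE : map gen (map val s) = s.
    by rewrite -map_comp -[RHS]map_id; apply: eq_map => x /=; exact: genK.
  rewrite -{1}sE -/(pword _) wE; last by rewrite size_map.
    rewrite [RHS]big_map; apply: eq_big_seq => v vN.
    by rewrite [weight (C _)]/weight valK.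
  by apply/allP => _ /mapP[x _ ->]; exact: (valP x).
Qed.

Lemma pwordE s : pword s = qword rel (map gen s).
Proof. by []. Qed.

End PosetAlg.

Opaque pword.

(* The relation r_a \sum_b r_b = 0 eliminates the product of r_a with the first
   element of [nlower a]; [C2 v a b] is the coordinate of r_a r_b on v. *)
Definition gen2 : seq (seq pt) :=
  [seq [:: a; b] | a <- gens, b <- behead (nlower a)].

Definition C2 (v : seq pt) (a b : pt) : int :=
  if v is [:: c; d] then
    if a == c then (b == d)%:R - (b == head Bot (nlower c))%:R else 0
  else 0.

(* The degree 3 part of r_a R_G is spanned by the word [word3 a], and
   [C3 a b c] is the coordinate of r_a r_b r_c on it.  It vanishes when a has
   rank at most 2 and for Y1 and Y2, where [word3] is a junk value. *)
Definition C3 (a b c : pt) : int :=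
  match a, b, c with
  | (Y3 | Y4), Ef1, Aa | (Y3 | Y4), Ef2, Aq => 1
  | (Y3 | Y4), Ef1, Aq | (Y3 | Y4), Ef2, Aa => -1
  | (W1 | W2), Y1, Ef1 | (W1 | W2), Y2, Ee => 1
  | (W1 | W2), Y1, Ee | (W1 | W2), Y2, Ef2 => -1
  | W1, Y3, Ef2 | W2, Y4, Ef2 => 1
  | W1, Y3, Ef1 | W2, Y4, Ef1 => -1
  | Top, W1, Y1 | Top, W2, Y2 => 1
  | Top, W1, Y2 | Top, W2, Y1 => -1
  | _, _, _ => 0
  end.

Definition tail3 (a : pt) : pt * pt :=
  match a with
  | Y3 | Y4 => (Ef1, Aa) | W1 | W2 => (Y1, Ef1) | _ => (W1, Y1)
  end.

Definition word3 a := [:: a; (tail3 a).1; (tail3 a).2].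

Local Ltac absurd_mem := try (let h := fresh in intro h; case (notF h)).

(** * Words of length 2, 3 and 4 *)

Section Dims.
Variable F : fieldType.
Local Notation rel := (@poset_rel F pt_display pposet).
Local Notation A := (quad_alg rel).
Local Notation pword := (pword F).

Lemma psumMr (f : pt -> A) s (u : A) : psum f s * u = psum (fun b => f b * u) s.
Proof. by rewrite !psumE mulr_suml. Qed.

Lemma psumMl (f : pt -> A) s (u : A) : u * psum f s = psum (fun b => u * f b) s.
Proof. by rewrite !psumE mulr_sumr. Qed.

Lemma nlower_neq0 a b : b \in nlower a -> b != Bot.
Proof. by rewrite mem_nlower => /andP[]. Qed.

Lemma pword_gen_lower a : a != Bot ->
  pword [:: a] * psum (fun b => pword [:: b]) (nlower a) = 0.
Proof.
move=> a0; rewrite -(pword_relS F a0) psumMl !psumE.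
by apply: eq_bigr => b _; rewrite -pword_cat.
Qed.

(** The relation at [a] multiplied on the right by r_c; the terms with r_b r_c = 0 are dropped. *)
Lemma pword3_col a c : a != Bot -> c != Bot ->
  psum (fun b => pword [:: a; b; c]) [seq b <- nlower a | c \in nlower b] = 0.
Proof.
move=> a0 c0; rewrite -[RHS](mul0r (pword [:: c])) -(pword_relS F a0) psumMr !psumE.
rewrite big_filter big_mkcond big_seq [RHS]big_seq; apply: eq_bigr => b ba.
rewrite -pword_cat; case: ifP => // /negbT cb.
by rewrite pword_cons pword_rel0 ?mulr0 // (nlower_neq0 ba).
Qed.

Lemma pword3_row a b : b != Bot -> psum (fun c => pword [:: a; b; c]) (nlower b) = 0.
Proof.
move=> b0; rewrite -[RHS](mulr0 (pword [:: a])) -(pword_relS F b0) psumMl !psumE.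
by apply: eq_bigr => c _; rewrite -pword_cat.
Qed.

Lemma add0_eq0 (V : zmodType) (x : V) : x + 0 = 0 -> x = 0.
Proof. by rewrite addr0. Qed.

Lemma add0_oppr (V : zmodType) (x y : V) : x + (y + 0) = 0 -> y = - x.
Proof. by rewrite addr0 addrC => /eqP; rewrite addr_eq0 => /eqP. Qed.

Lemma add0_oppl (V : zmodType) (x y : V) : x + (y + 0) = 0 -> x = - y.
Proof. by rewrite addr0 => /eqP; rewrite addr_eq0 => /eqP. Qed.

Lemma add0_oppr0 (V : zmodType) (x y z : V) :
  x + (y + (z + 0)) = 0 -> z = 0 -> y = - x.
Proof. by move=> h z0; apply: add0_oppr; rewrite -[RHS]h z0 !addr0. Qed.

Lemma eq_scale0 (w G : A) : w = 0 -> w = (0 : int)%:~R *: G.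
Proof. by move=> ->; rewrite scale0r. Qed.

Lemma eq_scale1 (w G : A) : w = G -> w = (1 : int)%:~R *: G.
Proof. by move=> ->; rewrite scale1r. Qed.

Lemma eq_scaleN1 (w G : A) : w = - G -> w = (-1 : int)%:~R *: G.
Proof. by move=> ->; rewrite mulrNz scaleNr scale1r. Qed.

(** For fixed [a] the words are the edges between [b] and [c] of the graph on the two ranks below
    [a]; by [pword3_row] and [pword3_col] the edges at each vertex sum to zero. Peeling off leaves
    kills the edges outside a cycle, and signs alternate along the cycle, of which there is at most
    one. *)
Lemma pword3_chain a b c : b \in nlower a -> c \in nlower b ->
  pword [:: a; b; c] = (C3 a b c)%:~R *: pword (word3 a).
Proof.
case: a; absurd_mem.
1-5: by case: b; absurd_mem; move=> _; case: c; absurd_mem.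
(* Below [Y1], and likewise below [Y2], the graph is a path, so every word vanishes. *)
- have ea := add0_eq0 (@pword3_row Y1 Ee isT).
  have fq := add0_eq0 (@pword3_col Y1 Aq isT isT).
  have := add0_oppl (@pword3_row Y1 Ef1 isT); rewrite fq oppr0 => fa.
  case: b; absurd_mem; move=> _; case: c; absurd_mem; move=> _.
  + exact: eq_scale0 ea.
  + exact: eq_scale0 fa.
  + exact: eq_scale0 fq.
- have ea := add0_eq0 (@pword3_row Y2 Ee isT).
  have fq := add0_eq0 (@pword3_col Y2 Aq isT isT).
  have := add0_oppl (@pword3_row Y2 Ef2 isT); rewrite fq oppr0 => fa.
  case: b; absurd_mem; move=> _; case: c; absurd_mem; move=> _.
  + exact: eq_scale0 ea.
  + exact: eq_scale0 fa.
  + exact: eq_scale0 fq.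
(* Once [Ap] and then the edge from [Eg1] to [Aa] are removed, the square on [Ef1], [Ef2], [Aa],
   [Aq] remains. *)
- have gp := add0_eq0 (@pword3_col Y3 Ap isT isT).
  have := add0_oppl (@pword3_row Y3 Eg1 isT); rewrite gp oppr0 => ga.
  have f1q := add0_oppr (@pword3_row Y3 Ef1 isT).
  have := add0_oppr (@pword3_col Y3 Aq isT isT); rewrite f1q opprK => f2q.
  have := add0_oppl (@pword3_row Y3 Ef2 isT); rewrite f2q => f2a.
  case: b; absurd_mem; move=> _; case: c; absurd_mem; move=> _.
  + exact: eq_scale1 erefl.
  + exact: eq_scaleN1 f1q.
  + exact: eq_scaleN1 f2a.
  + exact: eq_scale1 f2q.
  + exact: eq_scale0 ga.
  + exact: eq_scale0 gp.
- have gp := add0_eq0 (@pword3_col Y4 Ap isT isT).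
  have := add0_oppl (@pword3_row Y4 Eg2 isT); rewrite gp oppr0 => ga.
  have f1q := add0_oppr (@pword3_row Y4 Ef1 isT).
  have := add0_oppr (@pword3_col Y4 Aq isT isT); rewrite f1q opprK => f2q.
  have := add0_oppl (@pword3_row Y4 Ef2 isT); rewrite f2q => f2a.
  case: b; absurd_mem; move=> _; case: c; absurd_mem; move=> _.
  + exact: eq_scale1 erefl.
  + exact: eq_scaleN1 f1q.
  + exact: eq_scaleN1 f2a.
  + exact: eq_scale1 f2q.
  + exact: eq_scale0 ga.
  + exact: eq_scale0 gp.
(* The cycle is now the hexagon [Y1], [Ee], [Y2], [Ef2], [Y3], [Ef1]. *)
- have y1e := add0_oppl (@pword3_row W1 Y1 isT).
  have := add0_oppr (@pword3_col W1 Ee isT isT); rewrite y1e opprK => y2e.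
  have := add0_oppr (@pword3_row W1 Y2 isT); rewrite y2e => y2f2.
  have := add0_oppr (@pword3_col W1 Ef2 isT isT); rewrite y2f2 opprK => yf2.
  have yf1 := add0_oppr (@pword3_col W1 Ef1 isT isT).
  have yg := add0_eq0 (@pword3_col W1 Eg1 isT isT).
  case: b; absurd_mem; move=> _; case: c; absurd_mem; move=> _.
  + exact: eq_scaleN1 y1e.
  + exact: eq_scale1 erefl.
  + exact: eq_scale1 y2e.
  + exact: eq_scaleN1 y2f2.
  + exact: eq_scaleN1 yf1.
  + exact: eq_scale1 yf2.
  + exact: eq_scale0 yg.
- have y1e := add0_oppl (@pword3_row W2 Y1 isT).
  have := add0_oppr (@pword3_col W2 Ee isT isT); rewrite y1e opprK => y2e.
  have := add0_oppr (@pword3_row W2 Y2 isT); rewrite y2e => y2f2.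
  have := add0_oppr (@pword3_col W2 Ef2 isT isT); rewrite y2f2 opprK => yf2.
  have yf1 := add0_oppr (@pword3_col W2 Ef1 isT isT).
  have yg := add0_eq0 (@pword3_col W2 Eg2 isT isT).
  case: b; absurd_mem; move=> _; case: c; absurd_mem; move=> _.
  + exact: eq_scaleN1 y1e.
  + exact: eq_scale1 erefl.
  + exact: eq_scale1 y2e.
  + exact: eq_scaleN1 y2f2.
  + exact: eq_scaleN1 yf1.
  + exact: eq_scale1 yf2.
  + exact: eq_scale0 yg.
- have w1y3 := add0_eq0 (@pword3_col Top Y3 isT isT).
  have w2y4 := add0_eq0 (@pword3_col Top Y4 isT isT).
  have w2y1 := add0_oppr (@pword3_col Top Y1 isT isT).
  have w1y2 := add0_oppr0 (@pword3_row Top W1 isT) w1y3.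
  have := add0_oppr (@pword3_col Top Y2 isT isT); rewrite w1y2 opprK => w2y2.
  case: b; absurd_mem; move=> _; case: c; absurd_mem; move=> _.
  + exact: eq_scale1 erefl.
  + exact: eq_scaleN1 w1y2.
  + exact: eq_scale0 w1y3.
  + exact: eq_scaleN1 w2y1.
  + exact: eq_scale1 w2y2.
  + exact: eq_scale0 w2y4.
Qed.

Lemma C3_chain a b c : C3 a b c != 0 -> (b \in nlower a) && (c \in nlower b).
Proof. by case: a; case: b => //; case: c. Qed.

Lemma pword3 a b c : a != Bot -> b != Bot -> c != Bot ->
  pword [:: a; b; c] = (C3 a b c)%:~R *: pword (word3 a).
Proof.
move=> a0 b0 c0; have [ab|nab] := boolP (b \in nlower a); last first.
  have -> : C3 a b c = 0 by apply/eqP; apply: contraNT nab => /C3_chain/andP[].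
  rewrite (pword_cat _ [:: a; b] [:: c]) pword_rel0 // mul0r.
  by rewrite scale0r.
have [bc|nbc] := boolP (c \in nlower b); first exact: pword3_chain.
have -> : C3 a b c = 0 by apply/eqP; apply: contraNT nbc => /C3_chain/andP[].
by rewrite pword_cons pword_rel0 // mulr0 scale0r.
Qed.

(** The first three letters can be changed to [word3 a]. Unless [a] is [Top], the last three letters
    then have a zero [C3]. *)
Lemma pword4 a b c d : a != Bot -> b != Bot -> c != Bot -> d != Bot ->
  pword [:: a; b; c; d] = 0.
Proof.
have zero a' b' c' d' : b' != Bot -> c' != Bot -> d' != Bot ->
    C3 b' c' d' = 0 -> pword [:: a'; b'; c'; d'] = 0.
  by move=> h1 h2 h3 e; rewrite pword_cons pword3 // e scale0r mulr0.
have ext a' b' c' d' : a' != Bot -> b' != Bot -> c' != Bot ->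
    pword [:: a'; b'; c'; d'] = (C3 a' b' c')%:~R *: pword (rcons (word3 a') d').
  move=> h1 h2 h3; rewrite (pword_cat _ [:: a'; b'; c'] [:: d']) pword3 // -scalerAl.
  by rewrite -pword_cat.
move=> a0 b0 c0 d0; rewrite ext //.
have [e|] := eqVneq (C3 a b c) 0; first by rewrite e scale0r.
case: a a0 => // _; try by (move=> _; rewrite zero ?scaler0 //; case: (d)).
(* r_Top r_W1 r_Y1 is a multiple of r_Top r_W1 r_Y2, and r_Y2 r_Ef1 = 0. *)
move=> _; rewrite [rcons _ _]/= pword_cons pword3 // -scalerAr -pword_cons [_ :: word3 W1]/=.
have e0 : pword [:: Top; W1; Y2; Ef1] = 0 by apply: zero.
have e1 : pword [:: Top; W1; Y2; Ef1] = - pword [:: Top; W1; Y1; Ef1].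
  by rewrite (ext Top W1 Y2 Ef1) // mulrNz scaleNr scale1r.
have e : pword [:: Top; W1; Y1; Ef1] = 0 by apply: oppr_inj; rewrite oppr0 -e1.
by rewrite [pword _]e !scaler0.
Qed.

Lemma pword_large s : all (fun a => a != Bot) s -> (3 < size s)%N -> pword s = 0.
Proof.
case: s => [|a [|b [|c [|d s]]]] //= /and5P[a0 b0 c0 d0 _] _.
by rewrite (pword_cat _ [:: a; b; c; d] s) pword4 // mul0r.
Qed.

Lemma psum_pword_large a t : all (fun b => b != Bot) t -> (2 < size t)%N ->
  psum (fun b => pword [:: b]) (nlower a) * pword t = 0.
Proof.
move=> t0 st; rewrite psumMr psumE; apply: big1_seq => b /andP[_ bs].
by rewrite -pword_cat; apply: pword_large; rewrite //= (nlower_neq0 bs).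
Qed.

Lemma pword2 a b : a != Bot -> b != Bot ->
  pword [:: a; b] = \sum_(v <- gen2) (C2 v a b)%:~R *: pword v.
Proof.
move=> a0 b0; rewrite /gen2 big_allpairs_dep.
rewrite (bigD1_seq a) ?mem_gens //= [X in _ + X]big1_seq ?addr0; last first.
  move=> c /andP[ca _]; apply: big1 => d _.
  by rewrite /C2 eq_sym (negPf ca) scale0r.
under eq_bigr => d _ do rewrite /C2 eqxx.
have uN : uniq (nlower a) by rewrite -nlower_filter filter_uniq.
have := pword_relS F a0; have [ab|nab] := boolP (b \in nlower a); last first.
  move=> _; rewrite pword_rel0 // big1_seq // => d /andP[_ dl].
  have dN : d \in nlower a by apply: mem_behead.
  have bd : (b == d) = false by apply/negbTE; apply: contraNneq nab => ->.
  have bh : (b == head Bot (nlower a)) = false.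
    apply/negbTE; apply: contraNneq nab => ->; move: dN.
    by case: (nlower a) => // e l _; exact: mem_head.
  by rewrite bd bh subrr mulr0z scale0r.
move: ab uN; case: (nlower a) => // h l ab /= /andP[hl ul].
rewrite psumE => e; have [bh|bh] := eqVneq b h.
  rewrite bh in b0 ab *; move: e => /eqP; rewrite addr_eq0 => /eqP ->.
  rewrite -sumrN big_seq [RHS]big_seq; apply: eq_bigr => d dl.
  have hd : (h == d) = false by apply/negbTE; apply: contraNneq hl => ->.
  by rewrite hd sub0r mulrNz scaleNr scale1r.
have bl : b \in l by move: ab; rewrite inE (negPf bh).
rewrite (bigD1_seq b) //= eqxx subr0 scale1r big1_seq ?addr0 // => d /andP[db _].
by rewrite eq_sym (negPf db) subr0 mulr0z scale0r.
Qed.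

Lemma hilbert_poset_alg : hilbert_series (quad_grade (Q := rel)) rdim.
Proof.
case=> [|[|[|[|n]]]].
- apply: (@pt_has_dim _ _ [:: [::]] (fun _ s => (s == [::])%:R)) => //.
    move=> v _; split=> [s a b t _|s a t]; first by case: s.
    by case: s => [|c s]; exact: psum0.
  by case=> // _ _; rewrite big_seq1 /= mulr1n scale1r.
- apply: (@pt_has_dim _ _ [seq [:: a] | a <- gens] (fun v => deg1 (fun a => ([:: a] == v)%:R))) => //.
    by move=> v _; exact: annih_deg1.
  case=> // a [] // /andP[a0 _] _; rewrite big_map (bigD1_seq a) ?mem_gens //=.
  rewrite eqxx scale1r big1 ?addr0 // => b ba.
  by rewrite eqseq_cons eq_sym (negPf ba) scale0r.
- apply: (@pt_has_dim _ _ gen2 (fun v => deg2 (C2 v))) => //.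
    have h : all (fun v => check2 (C2 v)) gen2 by vm_compute.
    by move=> v /(allP h)/annih_deg2.
  by case=> // a [|b []] // /and3P[a0 b0 _] _; rewrite pword2.
- apply: (@pt_has_dim _ _ [seq word3 a | a <- [:: Y3; Y4; W1; W2; Top]]
    (fun v => deg3 (fun a b c => if a == head Bot v then C3 a b c else 0))) => //.
    have h : all (fun v => check3 (fun a b c => if a == head Bot v then C3 a b c else 0))
      [seq word3 a | a <- [:: Y3; Y4; W1; W2; Top]] by vm_compute.
    by move=> v /(allP h)/annih_deg3.
  case=> // a [|b [|c []]] // /and4P[a0 b0 c0 _] _; rewrite pword3 // big_map.
  have [e|] := eqVneq (C3 a b c) 0.
    by rewrite e scale0r big1 //= => d _; rewrite e if_same scale0r.
  have aN : C3 a b c != 0 -> a \in [:: Y3; Y4; W1; W2; Top] by case: (a); case: (b).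
  move=> /aN aN'; rewrite (bigD1_seq a) //= eqxx big1 ?addr0 // => d da.
  by rewrite eq_sym (negPf da) scale0r.
- have -> : rdim n.+4 = 0%N by rewrite /rdim nth_default.
  apply: (@pt_has_dim _ _ [::] (fun _ _ => 0)) => // s s0 ss.
  by rewrite big_nil pword_large // ss.
Qed.

End Dims.

Lemma pt_numerically_koszul (F : fieldType) :
  poset_alg_numerically_koszul F (pt : finBPOrderType pt_display).
Proof.
exists rdim, dual_dim; split; [exact: hilbert_poset_alg | exact: dual_hilbert |].
exact: koszul_numerics.
Qed.

(** * A cohomology class off the diagonal *)

Section OffDiagonal.
Variables (F : fieldType) (A : algType F) (gr : nat -> A -> Prop).

(** The unit and the generators lie on the diagonal, and products add bidegrees; off the diagonal
    only zero cochains arise. *)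
Lemma generated_off_diagonal n j (g : seq A -> F) :
  generated_by_Ext11 gr n j g -> n != j -> forall s, g s = 0.
Proof.
elim=> {n j g} [|f _|//|n j c f g _ IHf _ IHg nj s|n j n' j' f g _ IHf _ IHg nj s].
- by rewrite eqxx.
- by rewrite eqxx.
- by rewrite IHf // IHg // mulr0 addr0.
- rewrite /concat_product; have [e|/IHf -> //] := eqVneq n j; last by rewrite mul0r.
  by rewrite IHg ?mulr0 //; apply: contraNneq nj => ->; rewrite e.
Qed.

Lemma multilinear0 n (h : seq A -> F) s1 s2 :
  multilinear n h -> (size s1 + size s2).+1 = n -> h (s1 ++ 0 :: s2) = 0.
Proof.
move=> hm sn; have := hm s1 s2 1 0 0 sn.
by rewrite scale1r addr0 mul1r => /eqP; rewrite -subr_eq subrr eq_sym => /eqP.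
Qed.

End OffDiagonal.

(** * The trilinear form on words *)

Definition al a : int := if a is Top then 1 else 0.
Definition be a : int := if a is W1 then 1 else 0.
Definition ta a : int := match a with Y4 => 1 | Y1 => -1 | _ => 0 end.
Definition rho a : int := match a with Ee => 1 | Ef2 => -1 | _ => 0 end.
Definition tau a : int := match a with Aa => 1 | Aq => -1 | _ => 0 end.
Definition ka a b : int :=
  match a, b with Top, W1 => 1 | Top, W2 => -1 | _, _ => 0 end.
Definition bb a b : int :=
  match a, b with
  | W1, Y3 | W2, Y1 => 1 | W1, Y1 | W2, Y4 => -1 | _, _ => 0
  end.
Definition nu a b : int :=
  match a, b with
  | Y1, Ee | Y2, Ef2 | Y4, Ef1 => 1
  | Y1, Ef1 | Y2, Ee | Y4, Ef2 => -1
  | _, _ => 0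
  end.
Definition psi a b : int := C3 Y3 a b.
Definition phi a b c : int :=
  match a with Y3 => C3 Y3 b c | Y4 => - C3 Y4 b c | _ => 0 end.
Definition mu a b c : int :=
  match a with W1 => - C3 W1 b c | W2 => C3 W2 b c | _ => 0 end.
Definition chi a b c : int := if a is Top then C3 Top b c else 0.

(* The first product is dual to r_Top \otimes r_W1 \otimes u, with u in degree
   3.  It is not a cocycle: the five others, one for each other way of cutting
   a word of length 5 in three, compensate its coboundary. *)
Definition terms :=
  [:: (deg1 al, deg1 be, deg3 phi); (deg2 ka, deg1 ta, deg2 psi);
      (deg1 al, deg2 bb, deg2 psi); (deg1 al, deg3 mu, deg1 tau);
      (deg2 ka, deg2 nu, deg1 tau); (deg3 chi, deg1 rho, deg1 tau)].

(** The sum over [terms] written out on words, so that it evaluates over the integers. *)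
Definition value (u v w : seq pt) : int :=
  deg1 al u * deg1 be v * deg3 phi w + deg2 ka u * deg1 ta v * deg2 psi w +
  deg1 al u * deg2 bb v * deg2 psi w + deg1 al u * deg3 mu v * deg1 tau w +
  deg2 ka u * deg2 nu v * deg1 tau w + deg3 chi u * deg1 rho v * deg1 tau w.

Lemma value_terms u v w :
  value u v w = \sum_(t <- terms) t.1.1 u * t.1.2 v * t.2 w.
Proof. by rewrite !big_cons big_nil /= addr0 !addrA. Qed.

Lemma value_size u v w : (size u + size v + size w)%N <> 5 -> value u v w = 0.
Proof.
rewrite /value.
case: u => [|? [|? [|? [|? u]]]]; case: v => [|? [|? [|? [|? v]]]];
  case: w => [|? [|? [|? [|? w]]]] h;
  first [by case: (h erefl) | by rewrite /= !(mul0r, mulr0, addr0)].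
Qed.

(** The bar differential of [value] on four words. *)
Definition boundary_value u v w x : int :=
  value (u ++ v) w x - value u (v ++ w) x + value u v (w ++ x).

Definition all4 (P : pt -> pt -> pt -> pt -> bool) :=
  all_pts2 (fun a b => all_pts2 (P a b)).

Lemma pt_all4 P : all4 P -> forall a b c d, P a b c d.
Proof. by move=> h a b c d; apply: (pt_all2 (pt_all2 h a b)). Qed.

(** Only total length 5 and first letter [Top] matter, which leaves finitely many cases. *)
Lemma boundary_value0 u v w x :
    (0 < size u)%N -> (0 < size v)%N -> (0 < size w)%N -> (0 < size x)%N ->
  boundary_value u v w x = 0.
Proof.
move=> u0 v0 w0 x0.
have [h|h] := eqVneq (size u + size v + size w + size x)%N 5; last first.
  have {}h : (size u + size v + size w + size x)%N <> 5 by exact/eqP.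
  by rewrite /boundary_value !value_size // size_cat ?addnA // -addnA.
(* The first factors [al], [ka] and [chi] are all supported on words that begin with [Top]. *)
have top0 a : a != Top -> forall u' v' w', value (a :: u') v' w' = 0.
  move=> aT u' v' w'; rewrite /value; case: u' => [|b [|c [|d u']]] /=;
  case: a aT => // _; by rewrite !(mul0r, mulr0, addr0).
case: u u0 h => [//|a u] _; have [->|aT] := eqVneq a Top; last first.
  by rewrite /boundary_value !cat_cons !top0.
case: v v0 => [//|b v] _; case: w w0 => [//|c w] _; case: x x0 => [//|d x] _.
(* Four nonempty words of total length 5: exactly one has two letters, and each of its four
   positions is a finite check. *)
case: u => [|a' [|? u]]; case: v => [|b' [|? v]]; case: w => [|c' [|? w]];
  case: x => [|d' [|? x]]; try by rewrite /= !(addnS, addSn).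
all: move=> _.
- have h : all4 (fun b c d e => boundary_value [:: Top] [:: b] [:: c] [:: d; e] == 0).
    by vm_compute.
  exact: (eqP (pt_all4 h b c d d')).
- have h : all4 (fun b c d e => boundary_value [:: Top] [:: b] [:: c; d] [:: e] == 0).
    by vm_compute.
  exact: (eqP (pt_all4 h b c c' d)).
- have h : all4 (fun b c d e => boundary_value [:: Top] [:: b; c] [:: d] [:: e] == 0).
    by vm_compute.
  exact: (eqP (pt_all4 h b b' c d)).
- have h : all4 (fun b c d e => boundary_value [:: Top; b] [:: c] [:: d] [:: e] == 0).
    by vm_compute.
  exact: (eqP (pt_all4 h a' b c d)).
Qed.

Definition annih3 (t : (seq pt -> int) * (seq pt -> int) * (seq pt -> int)) :=
  [/\ annih t.1.1, annih t.1.2 & annih t.2].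

Lemma terms_annih : foldr and True (map annih3 terms).
Proof.
have hka : annih (deg2 ka) by apply: annih_deg2; vm_compute.
have hpsi : annih (deg2 psi) by apply: annih_deg2; vm_compute.
have hbb : annih (deg2 bb) by apply: annih_deg2; vm_compute.
have hnu : annih (deg2 nu) by apply: annih_deg2; vm_compute.
have hphi : annih (deg3 phi) by apply: annih_deg3; vm_compute.
have hmu : annih (deg3 mu) by apply: annih_deg3; vm_compute.
have hchi : annih (deg3 chi) by apply: annih_deg3; vm_compute.
by do 6! (split; first by split=> //; exact: annih_deg1).
Qed.

(** * The 3-cocycle and the failure of Koszulness *)

Section NotKoszul.
Variable F : fieldType.
Local Notation rel := (@poset_rel F pt_display pposet).
Local Notation A := (quad_alg rel).
Local Notation pword := (pword F).

Definition form (C : seq pt -> int) (a : A) : F := qform (weight F C) a.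

Definition tri (a b c : A) : F :=
  \sum_(t <- terms) form t.1.1 a * form t.1.2 b * form t.2 c.

Lemma form_lin C : annih C -> forall k a b, form C (k *: a + b) = k * form C a + form C b.
Proof. by move=> hC k a b; apply: qform_lin; exact: weight_annihilates. Qed.

Lemma eq_sum_terms f g :
    (forall t, annih3 t -> f t = g t) ->
  \sum_(t <- terms) f t = \sum_(t <- terms) g t :> F.
Proof.
move=> fg; have := terms_annih; elim: terms => [|t r IHr] /=.
  by rewrite !big_nil.
by case=> ht /IHr e; rewrite !big_cons fg ?e.
Qed.

Lemma tri_lin1 k a a' b c : tri (k *: a + a') b c = k * tri a b c + tri a' b c.
Proof.
rewrite /tri mulr_sumr -big_split /=; apply: eq_sum_terms => t [h1 h2 h3].
by rewrite form_lin // !mulrDl !mulrA.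
Qed.

Lemma tri_lin2 k a b b' c : tri a (k *: b + b') c = k * tri a b c + tri a b' c.
Proof.
rewrite /tri mulr_sumr -big_split /=; apply: eq_sum_terms => t [h1 h2 h3].
by rewrite form_lin //; ring.
Qed.

Lemma tri_lin3 k a b c c' : tri a b (k *: c + c') = k * tri a b c + tri a b c'.
Proof.
rewrite /tri mulr_sumr -big_split /=; apply: eq_sum_terms => t [h1 h2 h3].
by rewrite form_lin //; ring.
Qed.

Lemma tri_qword u v w : tri (qword rel u) (qword rel v) (qword rel w) =
  (value (map val u) (map val v) (map val w))%:~R.
Proof.
rewrite value_terms rmorph_sum /=; apply: eq_sum_terms => t [h1 h2 h3].
by rewrite /form !qform_word ?rmorphM //; exact: weight_annihilates.
Qed.

Lemma tri_pword u v w : all (fun a => a != Bot) u -> all (fun a => a != Bot) v ->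
  all (fun a => a != Bot) w -> tri (pword u) (pword v) (pword w) = (value u v w)%:~R.
Proof.
have vgen s : all (fun a => a != Bot) s -> map val (map gen s) = s.
  by elim: s => //= a s IHs /andP[a0 /IHs ->]; rewrite val_gen.
by move=> u0 v0 w0; rewrite !pwordE tri_qword !vgen.
Qed.

Lemma tri_0 a b c : [/\ tri 0 b c = 0, tri a 0 c = 0 & tri a b 0 = 0].
Proof.
have := tri_lin1 1 0 0 b c; have := tri_lin2 1 a 0 0 c; have := tri_lin3 1 a b 0 0.
rewrite !scale1r !addr0 !mul1r.
by do 3! (move=> /eqP; rewrite -subr_eq subrr eq_sym => /eqP ?).
Qed.

Lemma tri_homogeneous i j k (a b c : A) : (i + j + k)%N <> 5 ->
  quad_grade i a -> quad_grade j b -> quad_grade k c -> tri a b c = 0.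
Proof.
move=> ijk ha hb hc; move: a ha.
apply: quad_grade_ind => [|r a a' IHa IHa'|u su].
- by have [-> _ _] := tri_0 0 b c.
- by rewrite tri_lin1 IHa IHa' mulr0 addr0.
move: b hb; apply: quad_grade_ind => [|r b b' IHb IHb'|v sv].
- by have [_ -> _] := tri_0 (qword rel u) 0 c.
- by rewrite tri_lin2 IHb IHb' mulr0 addr0.
move: c hc; apply: quad_grade_ind => [|r c c' IHc IHc'|w sw].
- by have [_ _ ->] := tri_0 (qword rel u) (qword rel v) 0.
- by rewrite tri_lin3 IHc IHc' mulr0 addr0.
by rewrite tri_qword value_size // !size_map su sv sw.
Qed.

(** The linearity step in the reduction of [tri_cocycle] to words. *)
Lemma alternating_lin (k x y z x' y' z' : F) :
  x - y + z = 0 -> x' - y' + z' = 0 ->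
  k * x + x' - (k * y + y') + (k * z + z') = 0.
Proof.
move=> h h'; rewrite -[RHS](addr0 0) -{2}h' -[X in _ = X + _](mulr0 k) -h.
by ring.
Qed.

(** Applying [quad_grade_ind] to each argument in turn reduces the identity to words, where it is
    [boundary_value0]. *)
Lemma tri_cocycle i j k l (a b c d : A) :
    (0 < i)%N -> (0 < j)%N -> (0 < k)%N -> (0 < l)%N ->
    quad_grade i a -> quad_grade j b -> quad_grade k c -> quad_grade l d ->
  tri (a * b) c d - tri a (b * c) d + tri a b (c * d) = 0.
Proof.
move=> i0 j0 k0 l0 ha hb hc hd; move: a ha.
apply: quad_grade_ind => [|r a a' IHa IHa'|u su].
- rewrite mul0r; have [-> _ _] := tri_0 0 c d; have [-> _ _] := tri_0 0 (b * c) d.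
  by have [-> _ _] := tri_0 0 b (c * d); rewrite subrr addr0.
- rewrite mulrDl -scalerAl !tri_lin1; exact: alternating_lin IHa IHa'.
move: b hb; apply: quad_grade_ind => [|r b b' IHb IHb'|v sv].
- rewrite mul0r mulr0; have [-> _ _] := tri_0 0 c d.
  have [_ -> _] := tri_0 (qword rel u) 0 d; have [_ -> _] := tri_0 (qword rel u) 0 (c * d).
  by rewrite subrr addr0.
- rewrite mulrDl mulrDr -scalerAl -scalerAr tri_lin1 !tri_lin2; exact: alternating_lin IHb IHb'.
move: c hc; apply: quad_grade_ind => [|r c c' IHc IHc'|w sw].
- rewrite mul0r mulr0; have [_ -> _] := tri_0 (qword rel u * qword rel v) 0 d.
  have [_ -> _] := tri_0 (qword rel u) 0 d.
  have [_ _ ->] := tri_0 (qword rel u) (qword rel v) 0.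
  by rewrite subrr addr0.
- rewrite mulrDl mulrDr -scalerAl -scalerAr !tri_lin2 tri_lin3; exact: alternating_lin IHc IHc'.
move: d hd; apply: quad_grade_ind => [|r d d' IHd IHd'|x sx].
- rewrite mulr0; have [_ _ ->] := tri_0 (qword rel u * qword rel v) (qword rel w) 0.
  have [_ _ ->] := tri_0 (qword rel u) (qword rel v * qword rel w) 0.
  have [_ _ ->] := tri_0 (qword rel u) (qword rel v) 0.
  by rewrite subrr addr0.
- rewrite mulrDr -scalerAr !tri_lin3; exact: alternating_lin IHd IHd'.
rewrite -!qword_cat !tri_qword -rmorphB -rmorphD /= !map_cat.
by rewrite [X in X%:~R]boundary_value0 ?size_map ?su ?sv ?sw ?sx.
Qed.

Definition tri_cochain (s : seq A) : F :=
  if s is [:: a; b; c] then tri a b c else 0.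

Lemma tri_cochain_cocycle : cocycle (quad_grade (Q := rel)) 3 5 tri_cochain.
Proof.
split; [split|].
- move=> s1 s2 k a b; case: s1 => [|a1 [|a2 [|a3 s1]]]; case: s2 => [|b1 [|b2 [|b3 s2]]] //= _.
  + exact: tri_lin1.
  + exact: tri_lin2.
  + exact: tri_lin3.
- move=> ds [|a [|b [|c []]]] //= _ [].
  case: ds => [|i [|j [|k []]]] //= _ h; rewrite !addnA addn0 => ijk.
  have [_ ha] := h 0%N isT; have [_ hb] := h 1%N isT; have [_ hc] := h 2%N isT.
  exact: tri_homogeneous ijk ha hb hc.
- move=> ds [|a [|b [|c [|d []]]]] //= _ [].
  case: ds => [|i [|j [|k [|l []]]]] //= _ h.
  have [i0 ha] := h 0%N isT; have [j0 hb] := h 1%N isT.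
  have [k0 hc] := h 2%N isT; have [l0 hd] := h 3%N isT.
  rewrite /differential /= !big_ord_recl big_ord0 /= expr0 expr1 mul1r mulN1r addr0.
  rewrite exprS expr1 mulN1r opprK mul1r addrA.
  exact: tri_cocycle i0 j0 k0 l0 ha hb hc hd.
Qed.

Opaque tri.

(* As r_Top (r_W1 + r_W2) = 0 and R_G vanishes in degree 4, the tensor
   r_Top \otimes (r_W1 + r_W2) \otimes (r_Y3 r_Ef1 r_Aa) is a bar cycle. *)
Lemma pt_not_koszul : ~ poset_alg_koszul F pposet.
Proof.
move=> K; have [g gen_g [h [hm _] fh]] := K 3 5 tri_cochain tri_cochain_cocycle.
pose rT : A := pword [:: Top].
pose sT : A := psum (fun b => pword [:: b]) (nlower Top).
pose u : A := pword [:: Y3; Ef1; Aa].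
have rs : rT * sT = 0 by exact: pword_gen_lower.
have sE : sT = 1 *: pword [:: W1] + pword [:: W2].
  by rewrite scale1r; congr (_ + _); exact: addr0.
have su : sT * u = 0 by exact: psum_pword_large.
have hom : homogeneous (quad_grade (Q := rel)) [:: 1; 1; 3]%N [:: rT; sT; u].
  split=> // -[|[|[|i]]] //= _; split=> //.
  - by rewrite /rT pwordE; exact: (quad_grade_qword rel [:: gen Top]).
  - rewrite sE; apply: quad_gradeD; [rewrite pwordE; exact: (quad_grade_qword rel [:: gen W1])|].
    rewrite pwordE; exact: (quad_grade_qword rel [:: gen W2]).
  - by rewrite /u pwordE; exact: (quad_grade_qword rel (map gen [:: Y3; Ef1; Aa])).
(* Both adjacent products in the tensor are zero, so every coboundary vanishes on it. *)
have dh0 : differential h [:: rT; sT; u] = 0.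
  rewrite /differential /= !big_ord_recl big_ord0 /merge_at /= rs su.
  rewrite (multilinear0 (s1 := [::]) hm) // (multilinear0 (s1 := [:: rT]) hm) //.
  by rewrite !mulr0 !addr0.
(* Only the first product in [terms] accepts lengths 1, 1, 3; its factor [be] keeps [W1] and kills
   [W2]. *)
have tri1 : tri rT sT u = 1.
  rewrite sE tri_lin2.
  have t1 : tri rT (pword [:: W1]) u = 1 := @tri_pword [:: Top] [:: W1] [:: Y3; Ef1; Aa] isT isT isT.
  have t2 : tri rT (pword [:: W2]) u = 0 := @tri_pword [:: Top] [:: W2] [:: Y3; Ef1; Aa] isT isT isT.
  apply: etrans (congr2 (fun x y => 1 * x + y) t1 t2) _.
  by rewrite mul1r addr0.
(* As 3 differs from 5, [g] is zero, and the cocycle would be the coboundary of [h]. *)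
have := fh [:: 1; 1; 3]%N [:: rT; sT; u] erefl hom.
rewrite dh0 (generated_off_diagonal gen_g) // subr0 /= tri1 => /eqP.
by rewrite oner_eq0.
Qed.

End NotKoszul.

Theorem theorem1p3 (F : fieldType) :
  (exists (disp : Order.disp_t) (G : finBPOrderType disp),
     [/\ ranked_poset G, uniform_poset G,
         poset_alg_numerically_koszul F G & ~ poset_alg_koszul F G]) /\
  (exists (disp : Order.disp_t) (G : finBPOrderType disp),
     [/\ ranked_poset G, uniform_poset G, cyclic_poset G,
         poset_alg_numerically_koszul F G & ~ poset_alg_koszul F G]).
Proof.
split; exists pt_display, (pt : finBPOrderType pt_display); split;
  by [exact: pt_ranked | exact: pt_uniform | exact: pt_cyclic
     | exact: pt_numerically_koszul | exact: pt_not_koszul].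
Qed.
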